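(* Let $Y_1,\dots,Y_m\in\mathbb{R}^{2n\times n}$ be frames and $w_{i,j}=Y_i^T\mathcal{J}Y_j$. With $\mathcal W,\tilde{\mathcal M},\mathcal M,\mathcal D,S_{1,\dots,m-1},S_{2,\dots,m-1},\bar S_{1,\dots,m-1}$ as defined in the context, the cyclic sums of the second kind satisfy $$\nu_c^{\pm}(Y_1,\dots,Y_m)=\operatorname{rank}\tilde{\mathcal M}+\operatorname{ind}\bigl(\pm F_{\mathcal W}\,S_{1,2,\dots,m-1}\,F_{\mathcal W}\bigr),\qquad m\ge 2,$$ $$\nu_c^{\pm}(Y_1,\dots,Y_m)=\operatorname{ind}(\pm\bar S_{1,2,\dots,m-1})=\operatorname{rank}\tilde{\mathcal M}+\operatorname{ind}\bigl(\pm F_{\tilde{\mathcal M}}(S_{2,3,\dots,m-1}-\mathcal D-\mathcal D^T)F_{\tilde{\mathcal M}}\bigr),\qquad m\ge 3.$$ Moreover, these formulas remain true when $\tilde{\mathcal M}$ is replaced by $\mathcal M$ (everywhere, including in $\bar S_{1,\dots,m-1}$).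
   Context: $\mathcal{J}=\begin{pmatrix}0&I\\-I&0\end{pmatrix}\in\mathbb{R}^{2n\times 2n}$ and $w(Y,\hat Y)=Y^T\mathcal{J}\hat Y$. For a real symmetric matrix $A$, $\operatorname{ind}A$ is the number of negative eigenvalues counted with multiplicity. $A^{\dagger}$ is the Moore–Penrose pseudoinverse, $E_A=I-AA^{\dagger}$, $F_A=I-A^{\dagger}A$. A frame is a real $2n\times n$ matrix $Y$ with $w(Y,Y)=0$ and $\operatorname{rank}Y=n$. For frames $Y=\binom{X}{U}$, $\hat Y=\binom{\hat X}{\hat U}$ ($n\times n$ blocks) put $\mathcal M_0=(I-X^{\dagger}X)\,w(Y,\hat Y)$, $\mathcal T=I-\mathcal M_0^{\dagger}\mathcal M_0$, $\mathcal P=\mathcal T\,w(Y,\hat Y)^T X^{\dagger}\hat X\,\mathcal T$ (symmetric), and define the comparative index and dual comparative index $\mu(Y,\hat Y)=\operatorname{rank}\mathcal M_0+\operatorname{ind}\mathcal P$, $\mu^*(Y,\hat Y)=\operatorname{rank}\mathcal M_0+\operatorname{ind}(-\mathcal P)$. Cyclic sums of the second kind, $m\ge2$: $\nu_c^-(Y_1,\dots,Y_m)=\sum_{k=1}^{m-1}\mu(Y_k,Y_{k+1})-\mu(Y_1,Y_m)$, $\nu_c^+(Y_1,\dots,Y_m)=\sum_{k=1}^{m-1}\mu^*(Y_k,Y_{k+1})-\mu^*(Y_1,Y_m)$. For indices $a<a+1<\dots<b$, $S_{a,\dots,b}$ is the symmetric block matrix with zero diagonal $n\times n$ blocks, with block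 $w_{i,j}$ in the position of row-index $i$ and column-index $j$ for $a\le i<j\le b$, and block $w_{i,j}^T$ in the transposed position; for a single index $S_a:=0_n$ (the $n\times n$ zero matrix). $\mathcal W=(w_{m,1}\;w_{m,2}\;\dots\;w_{m,m-1})\in\mathbb{R}^{n\times(m-1)n}$ for $m\ge2$. For $m\ge 3$: $\mathcal N=(w_{m,2}\;w_{m,3}\;\dots\;w_{m,m-1})$ and $\mathcal K=(w_{1,2}\;w_{1,3}\;\dots\;w_{1,m-1})$, both in $\mathbb{R}^{n\times(m-2)n}$; $\tilde{\mathcal M}=E_{w_{m,1}}\mathcal N$, $\mathcal M=F_{w_{m,1}}\mathcal K$, $\mathcal D=\mathcal K^T w_{m,1}^{\dagger}\mathcal N$, and $$\bar S_{1,2,\dots,m-1}=\begin{pmatrix}0&\tilde{\mathcal M}\\ \tilde{\mathcal M}^T&S_{2,3,\dots,m-1}-\mathcal D-\mathcal D^T\end{pmatrix}.$$ For $m=2$ the matrices $\tilde{\mathcal M},\mathcal M$ are empty and have rank $0$. *)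

(* Defs.v *)
From mathcomp Require Import all_boot all_order all_algebra.
From mathcomp Require Import classical_sets reals.
From mathcomp Require Import polyrcf.

Set Implicit Arguments.
Unset Strict Implicit.
Unset Printing Implicit Defensive.

Import Order.TTheory GRing.Theory Num.Theory.
Local Open Scope ring_scope.

Section LinearAlgebra.
Variable R : realType.

Definition is_pinv p q (A : 'M[R]_(p, q)) (B : 'M[R]_(q, p)) : Prop :=
  [/\ A *m B *m A = A, B *m A *m B = B,
      (A *m B)^T = A *m B & (B *m A)^T = B *m A].

(* The Moore-Penrose pseudoinverse. The default value 0 is never used: see
   [pinvP] for existence and [pinv_uniq] for uniqueness. *)
Definition pinv p q (A : 'M[R]_(p, q)) : 'M[R]_(q, p) :=
  xget 0 [set B | is_pinv A B].

Lemma row_free_gram p q (A : 'M[R]_(p, q)) :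
  row_free A -> A *m A^T \in unitmx.
Proof.
move=> fA; rewrite -row_free_unit -kermx_eq0; apply/eqP/row_matrixP => i.
rewrite row0; set u := row i _.
have uG : u *m (A *m A^T) = 0 by rewrite /u -row_mul mulmx_ker row0.
have uA : u *m A = 0.
  have : (u *m A) *m (u *m A)^T = 0.
    by rewrite trmx_mul !mulmxA -(mulmxA u) uG mul0mx.
  move/matrixP/(_ 0 0); rewrite !mxE.
  under eq_bigr => j _ do rewrite [(u *m A)^T _ _]mxE -expr2.
  move/eqP; rewrite psumr_eq0 => [/allP h|j _]; last exact: sqr_ge0.
  apply/rowP => j; rewrite [RHS]mxE; apply/eqP; rewrite -sqrf_eq0.
  by apply: h; rewrite mem_index_enum.
by apply: (row_free_inj fA); rewrite uA mul0mx.
Qed.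

Lemma pinv_ex p q (A : 'M[R]_(p, q)) : exists B, is_pinv A B.
Proof.
have [r [C [D [eA fC fD]]]] : exists r (C : 'M_(p, r)) (D : 'M_(r, q)),
    [/\ A = C *m D, row_free C^T & row_free D].
  exists (\rank A), (col_base A), (row_base A); split.
  - by rewrite mulmx_base.
  - by rewrite /row_free mxrank_tr; have := col_base_full A.
  - exact: row_base_free.
have uD : D *m D^T \in unitmx by apply: row_free_gram.
have uC : C^T *m C \in unitmx by rewrite -{2}[C]trmxK; apply: row_free_gram.
pose g : 'M_r := invmx (D *m D^T); pose h : 'M_r := invmx (C^T *m C).
have DDg : D *m D^T *m g = 1%:M by rewrite mulmxV.
have hCC : h *m (C^T *m C) = 1%:M by rewrite mulVmx.
have gT : g^T = g by rewrite /g trmx_inv trmx_mul trmxK.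
have hT : h^T = h by rewrite /h trmx_inv trmx_mul trmxK.
pose B := D^T *m g *m (h *m C^T).
have eAB : A *m B = C *m h *m C^T.
  by rewrite {1}eA /B !mulmxA -(mulmxA C D) -(mulmxA C (D *m _)) DDg mulmx1.
have eBA : B *m A = D^T *m g *m D.
  by rewrite {1}eA /B -!mulmxA (mulmxA C^T) (mulmxA h) hCC mul1mx.
exists B; split.
- by rewrite eAB {1}eA -!mulmxA (mulmxA C^T) (mulmxA h) hCC mul1mx -eA.
- by rewrite eBA /B !mulmxA -(mulmxA (D^T *m g) D) -(mulmxA (D^T *m g) (D *m _)) DDg mulmx1.
- by rewrite eAB !trmx_mul trmxK hT mulmxA.
- by rewrite eBA !trmx_mul trmxK gT mulmxA.
Qed.

Lemma pinvP p q (A : 'M[R]_(p, q)) : is_pinv A (pinv A).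
Proof. exact: (xgetPex _ (pinv_ex A)). Qed.

Lemma pinv_uniq p q (A : 'M[R]_(p, q)) B : is_pinv A B -> B = pinv A.
Proof.
case=> [b1 b2 b3 b4]; case: (pinvP A); move: (pinv A) => C c1 c2 c3 c4.
have AB : A *m B = A *m C.
  by rewrite -{1}c1 -mulmxA -c3 -b3 -trmx_mul mulmxA b1 c3.
have BA : B *m A = C *m A.
  by rewrite -{1}c1 !mulmxA -mulmxA -b4 -c4 -trmx_mul -mulmxA (mulmxA A) b1 c4.
by rewrite -b2 BA -mulmxA AB mulmxA c2.
Qed.

Definition Emx p q (A : 'M[R]_(p, q)) : 'M[R]_p := 1%:M - A *m pinv A.
Definition Fmx p q (A : 'M[R]_(p, q)) : 'M[R]_q := 1%:M - pinv A *m A.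

(* [rootsR] lists the distinct roots, hence the weights [mup]. *)
Definition ind p (A : 'M[R]_p) : nat :=
  (\sum_(x <- rootsR (char_poly A) | (x < 0)%R) mup x (char_poly A))%N.

End LinearAlgebra.

Section Frames.
Variables (R : realType) (n : nat).

Definition Jmx : 'M[R]_(n + n) := block_mx 0 1%:M (- 1%:M) 0.

Definition wron (Y Z : 'M[R]_(n + n, n)) : 'M[R]_n := Y^T *m Jmx *m Z.

Definition frame (Y : 'M[R]_(n + n, n)) : Prop :=
  wron Y Y = 0 /\ \rank Y = n.

Definition ciM (Y Z : 'M[R]_(n + n, n)) : 'M[R]_n :=
  Fmx (usubmx Y) *m wron Y Z.

Definition ciP (Y Z : 'M[R]_(n + n, n)) : 'M[R]_n :=
  let T := Fmx (ciM Y Z) in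
  T *m (wron Y Z)^T *m pinv (usubmx Y) *m usubmx Z *m T.

Definition mu (Y Z : 'M[R]_(n + n, n)) : nat :=
  (\rank (ciM Y Z) + ind (ciP Y Z))%N.

Definition mu_dual (Y Z : 'M[R]_(n + n, n)) : nat :=
  (\rank (ciM Y Z) + ind (- ciP Y Z))%N.

End Frames.

(* A tuple (Y_1, ..., Y_m) is given by a sequence Y : nat -> _, of which only
   the entries Y 1, ..., Y m are used. *)
Section CyclicSums.
Variables (R : realType) (n : nat) (Y : nat -> 'M[R]_(n + n, n)) (m : nat).

Definition w (i j : nat) : 'M[R]_n := wron (Y i) (Y j).

Definition nu_minus : int :=
  \sum_(1 <= k < m) (mu (Y k) (Y k.+1))%:Z - (mu (Y 1) (Y m))%:Z.

Definition nu_plus : int :=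
  \sum_(1 <= k < m) (mu_dual (Y k) (Y k.+1))%:Z - (mu_dual (Y 1) (Y m))%:Z.

(* [Smx a l] is S_{a, a+1, ..., a+l-1}: first index a, l block rows. *)
Definition Smx (a l : nat) : 'M[R]_(\sum_(i < l) n) :=
  \mxblock_(i < l, j < l)
    (if (i < j)%N then w (a + i) (a + j)
     else if (j < i)%N then (w (a + j) (a + i))^T else 0).

Definition Wmx : 'M[R]_(n, \sum_(j < m - 1) n) :=
  \mxrow_(j < m - 1) w m (1 + j).

(* For m = 2 the following matrices have no columns. *)
Definition Nmx : 'M[R]_(n, \sum_(j < m - 2) n) :=
  \mxrow_(j < m - 2) w m (2 + j).

Definition Kmx : 'M[R]_(n, \sum_(j < m - 2) n) :=
  \mxrow_(j < m - 2) w 1 (2 + j).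

Definition Mtilde : 'M[R]_(n, \sum_(j < m - 2) n) := Emx (w m 1) *m Nmx.

Definition Mmx : 'M[R]_(n, \sum_(j < m - 2) n) := Fmx (w m 1) *m Kmx.

Definition Dmx : 'M[R]_(\sum_(j < m - 2) n) := Kmx^T *m pinv (w m 1) *m Nmx.

Definition SDmx : 'M[R]_(\sum_(j < m - 2) n) := Smx 2 (m - 2) - Dmx - Dmx^T.

(* \bar S, with its off-diagonal block as a parameter X: either Mtilde or Mmx. *)
Definition Sbar (X : 'M[R]_(n, \sum_(j < m - 2) n)) :
    'M[R]_(n + \sum_(j < m - 2) n) :=
  block_mx 0 X X^T SDmx.

End CyclicSums.

(* Main.v *)
(* Choose a real t such that C_k = U_k - t X_k is invertible for all k: this is
   a Lagrangian plane transversal to every Y_k. In the corresponding chart Y_k is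
   the graph of a symmetric matrix Q_k, and w_ij is congruent to Q_j - Q_i
   through C_i and C_j. With signs e_li = 1 for i <= l and -1 for i > l,
     2 (Q_j - Q_i) = sum_l e_li e_lj D_l   for i <= j,
   where D_l = Q_l - Q_(l+1), cyclically. Hence S_(1..m) is congruent to
   diag(D_1, .., D_m) and its index is the cyclic sum of h(k, k+1), where
   h(i, j) = ind (Q_i - Q_j). For the triple (-V, Y, Z) with V the vertical
   plane, eliminating V from the block form gives
   mu^*(Y, Z) = h(Y, Z) + h(Z, V) - h(Y, V). The terms with V telescope, so
   nu^+ is the sum of h(k, k+1) minus h(1, m), that is,
   ind S_(1..m) - rank w_(m,1). The formulas of the theorem are different
   block eliminations of S_(1..m) in the cyclically shifted order
   (-Y_m, Y_1, .., Y_(m-1)). The minus case is the same with -S. *)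
Require Import Defs.
From mathcomp Require Import all_boot all_order all_algebra.
From mathcomp Require Import classical_sets reals.
From mathcomp Require Import polyrcf.
From mathcomp Require Import sesquilinear spectral complex.
From mathcomp Require Import ring lra zify.

Set Implicit Arguments.
Unset Strict Implicit.
Unset Printing Implicit Defensive.

Import Order.TTheory GRing.Theory Num.Theory.
Local Open Scope ring_scope.

(** * Inertia of real symmetric matrices *)

Section Inertia.
Variable R : realType.
Local Notation C := R[i]%C.
Local Notation toC := (map_mx (real_complex R)).
Local Notation "M ^*T" := (map_mx Num.conj M^T) (at level 8).

(** Exchanging the two sums counts each negative entry of [s] once, because [rootsR] is
    duplicate-free. *)
Lemma ind_char_poly p (A : 'M[R]_p) (s : seq R) :
  char_poly A = \prod_(x <- s) ('X - x%:P) ->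
  ind A = count (fun x => x < 0) s.
Proof.
move=> eA; rewrite /ind eA.
under eq_bigr => x _ do rewrite mu_prod_XsubC -sum1_count big_mkcond /=.
rewrite exchange_big /= -sum1_count [RHS]big_mkcond /=.
apply: eq_big_seq => y ys.
have yr : y \in rootsR (\prod_(x <- s) ('X - x%:P)).
  have nz : \prod_(x <- s) ('X - x%:P) != 0 :> {poly R}.
    by rewrite monic_neq0 // monic_prod_XsubC.
  by rewrite -(roots_on_rootsR nz) in_itv /= root_prod_XsubC.
have [y0|y0] := ifPn; last first.
  by rewrite big1 // => x x0; case: eqP y0 => // ->; rewrite x0.
rewrite big_mkcond (bigD1_seq y) ?uniq_roots //= y0 eqxx big1 // => x xy.
by rewrite eq_sym (negPf xy) if_same.
Qed.

Lemma ind_char_poly_card p (A : 'M[R]_p) (r : 'rV[R]_p) :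
  char_poly A = \prod_i ('X - (r 0 i)%:P) ->
  ind A = #|[pred i | r 0 i < 0]|.
Proof.
move=> cA; rewrite (@ind_char_poly _ _ [seq r 0 i | i <- enum 'I_p]).
  by rewrite count_map cardE enumT /enum_mem size_filter.
by rewrite big_map big_enum.
Qed.

Lemma char_poly_similar (F : fieldType) p (P A B : 'M[F]_p) :
  P \in unitmx -> P *m A = B *m P -> char_poly A = char_poly B.
Proof.
move=> Pu PA; have nz : \det (map_mx (@polyC F) P) != 0.
  by rewrite det_map_mx polyC_eq0 -unitfE -unitmxE.
apply: (mulfI nz); rewrite /char_poly [in RHS]mulrC -!det_mulmx /char_poly_mx.
by rewrite mulmxBr mulmxBl -!map_mxM PA scalar_mxC.
Qed.

(** The diagonalisation is complex but the eigenvalues are real, and real polynomials embed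
    injectively. *)
Lemma char_poly_diag p (A : 'M[R]_p) (P : 'M[C]_p) (r : 'rV[R]_p) :
  P \in unitmx -> P *m toC A = diag_mx (toC r) *m P ->
  char_poly A = \prod_i ('X - (r 0 i)%:P).
Proof.
move=> Pu PA; apply: (map_inj_poly (@complexI R)); first by rewrite rmorph0.
rewrite map_char_poly rmorph_prod /= (char_poly_similar Pu PA).
rewrite char_poly_trig ?diag_mx_is_trig //; apply: eq_bigr => i _.
by rewrite rmorphB /= map_polyX map_polyC /= !mxE eqxx.
Qed.

(** Factoring through the nonzero positions bounds the rank above; the invertible submatrix on them
    bounds it below. *)
Lemma rank_diag_mx (F : fieldType) p (d : 'rV[F]_p) :
  \rank (diag_mx d) = #|[pred i | d 0 i != 0]|.
Proof.
set N := [pred i | _]; pose f := @enum_val _ N.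
have fI : injective f by apply: enum_val_inj.
apply/eqP; rewrite eqn_leq; apply/andP; split.
  have -> : diag_mx d = colsub f (diag_mx d) *m rowsub f 1%:M.
    apply/matrixP => i j; rewrite !mxE; have [Nj|/negPn/eqP dj] := boolP (d 0 j != 0).
      have jN : j \in N by [].
      rewrite (bigD1 (enum_rank_in jN j)) //= !mxE /f enum_rankK_in // eqxx mulr1.
      rewrite big1 ?addr0 // => l lj; rewrite !mxE [_ == j](negPf _) ?mulr0 //.
      by apply: contra lj => /eqP e; apply/eqP/fI; rewrite /f enum_rankK_in.
    have -> : d 0 i *+ (i == j) = 0 by case: eqP => [->|]; rewrite ?dj.
    rewrite big1 // => l _; rewrite !mxE [f l == j](negPf _) ?mulr0 //.
    apply/eqP => lj.
    by have := enum_valP l; rewrite inE -/(f l) lj dj eqxx.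
  by apply: (leq_trans (mxrankM_maxl _ _)); rewrite rank_leq_col.
have : diag_mx (colsub f d) = rowsub f 1%:M *m diag_mx d *m colsub f 1%:M.
  rewrite mul_rowsub_mx mul1mx mulmx_colsub mulmx1; apply/matrixP => i j.
  by rewrite !mxE (inj_eq fI).
move=> e; have <- : \rank (diag_mx (colsub f d)) = #|N|.
  apply: mxrank_unit; rewrite unitmxE det_diag unitfE; apply/prodf_neq0 => i _.
  by rewrite mxE; have := enum_valP i.
by rewrite e; apply: (leq_trans (mxrankM_maxl _ _)); apply: mxrankM_maxr.
Qed.

(** A real symmetric matrix is Hermitian over [C], so the complex spectral theorem applies. *)
Lemma sym_spectral p (A : 'M[R]_p) : A^T = A ->
  exists (P : 'M[C]_p) (r : 'rV[R]_p),
  [/\ P *m P^*T = 1%:M, P *m toC A *m P^*T = diag_mx (toC r)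
    & char_poly A = \prod_i ('X - (r 0 i)%:P)].
Proof.
move=> sA.
have hA : toC A \is hermsymmx.
  apply: realsym_hermsym.
    by apply/is_hermitianmxP; rewrite expr0 scale1r map_mx_id // map_trmx sA.
  by apply/mxOverP => i j; rewrite mxE complex_real.
have [/orthomx_spectralP eA rd] := (hermitian_normalmx hA,
  hermitian_spectral_diag_real hA).
set P := spectralmx _ in eA; set d := spectral_diag _ in eA rd.
have uP : P \is unitarymx by apply: spectral_unitarymx.
have PP : P *m P^*T = 1%:M by apply/unitarymxP.
pose r : 'rV[R]_p := map_mx (@complex.Re R) d.
have er : toC r = d.
  by apply/rowP => i; rewrite !mxE RRe_real //; move/mxOverP: rd; apply.
exists P, r; split => //.
  by rewrite eA invmx_unitary // !mulmxA PP mul1mx -mulmxA PP mulmx1 er.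
apply: (char_poly_diag (unitarymx_unit uP)).
by rewrite er eA !mulmxA mulmxV ?mul1mx // unitarymx_unit.
Qed.

Definition hform p (A : 'M[R]_p) (v : 'rV[C]_p) : C :=
  (v *m toC A *m v^*T) 0 0.

(** This makes the rows of [U] independent, since a vanishing combination has value 0. *)
Definition neg_def p (A : 'M[R]_p) k (U : 'M[C]_(k, p)) :=
  forall a : 'rV[C]_k, a != 0 -> hform A (a *m U) < 0.

Lemma hform_diag p (A : 'M[R]_p) k (U : 'M[C]_(k, p)) (d : 'rV[R]_k)
    (a : 'rV[C]_k) :
  U *m toC A *m U^*T = diag_mx (toC d) ->
  hform A (a *m U) = \sum_j (d 0 j)%:C%C * `|a 0 j| ^+ 2.
Proof.
move=> eU; rewrite /hform trmx_mul map_mxM -!mulmxA (mulmxA (toC A)).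
rewrite (mulmxA U) (mulmxA U) eU mul_diag_mx mxE.
by apply: eq_bigr => j _; rewrite !mxE normCK mulrCA.
Qed.

Lemma spectral_rowsub p (A : 'M[R]_p) (P : 'M[C]_p) (r : 'rV[R]_p)
    k (f : 'I_k -> 'I_p) : injective f ->
  P *m toC A *m P^*T = diag_mx (toC r) ->
  rowsub f P *m toC A *m (rowsub f P)^*T = diag_mx (toC (colsub f r)).
Proof.
move=> fI eA; rewrite mul_rowsub_mx; apply/matrixP => i j.
transitivity ((P *m toC A *m P^*T) (f i) (f j)).
  by rewrite !mxE; apply: eq_bigr => l _; rewrite !mxE.
by rewrite eA !mxE (inj_eq fI).
Qed.

(** The eigenvectors with negative eigenvalues serve as rows. With [neg_def_le], [ind A] is the
    largest dimension of a negative subspace. *)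
Lemma neg_def_ex p (A : 'M[R]_p) : A^T = A ->
  exists U : 'M[C]_(ind A, p), neg_def A U.
Proof.
move=> sA; have [P [r [_ eA cA]]] := sym_spectral sA.
pose N := [pred i | r 0 i < 0].
have -> : ind A = #|N| := ind_char_poly_card cA.
exists (rowsub (@enum_val _ N) P) => a a0.
rewrite (hform_diag _ (spectral_rowsub enum_val_inj eA)).
have [j aj] : exists j, a 0 j != 0.
  by apply/rV0Pn.
have neg i : ((colsub (@enum_val _ N) r) 0 i)%:C%C < 0 :> C.
  by rewrite mxE ltcR; have := enum_valP i.
rewrite (bigD1 j) //= ltr_wnDr //.
  apply: sumr_le0 => i _; apply: mulr_le0_ge0; first exact: ltW.
  by rewrite exprn_ge0.
by rewrite nmulr_rlt0 ?exprn_gt0 ?normr_gt0.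
Qed.

(* A negative subspace meets the span of the eigenvectors with nonnegative
   eigenvalues only in 0, which bounds its dimension. *)
Lemma neg_def_le p (A : 'M[R]_p) k (U : 'M[C]_(k, p)) : A^T = A ->
  neg_def A U -> (k <= ind A)%N.
Proof.
move=> sA nU; have [P [r [PP eA cA]]] := sym_spectral sA.
pose N := [pred i | r 0 i < 0].
have -> : ind A = #|N| := ind_char_poly_card cA.
set N' := [predC N]; pose W := rowsub (@enum_val _ N') P.
have WW : W *m W^*T = 1%:M.
  rewrite mul_rowsub_mx; apply/matrixP => i j.
  transitivity ((P *m P^*T) (enum_val i) (enum_val j)).
    by rewrite !mxE; apply: eq_bigr => l _; rewrite !mxE.
  by rewrite PP !mxE (inj_eq enum_val_inj).
have freeUW : row_free (col_mx U W).
  apply: inj_row_free => v; rewrite -[v]hsubmxK mul_row_col.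
  set a := lsubmx v; set b := rsubmx v => /eqP; rewrite addr_eq0 -mulNmx => /eqP e.
  have a0 : a = 0.
    apply/eqP; apply: contraT => /nU; rewrite e.
    rewrite (hform_diag _ (spectral_rowsub enum_val_inj eA)) => lt0.
    suff: 0 < 0 :> C by rewrite ltxx.
    apply: le_lt_trans lt0; apply: sumr_ge0 => j _.
    rewrite mulr_ge0 ?exprn_ge0 // mxE lecR leNgt.
    by have := enum_valP j; rewrite !inE.
  suff b0 : b = 0 by rewrite a0 b0 row_mx0.
  apply: oppr_inj; rewrite oppr0.
  by rewrite -[LHS]mulmx1 -WW mulmxA -e a0 !mul0mx.
have := rank_leq_col (col_mx U W); rewrite (eqP freeUW).
by rewrite -[X in (_ <= X)%N]card_ord -(cardC N) leq_add2r.
Qed.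

(* P may be rectangular: a subspace on which the pulled back form is negative
   maps injectively to one on which A is. *)
Lemma ind_congr_le p q (A : 'M[R]_p) (P : 'M[R]_(q, p)) : A^T = A ->
  (ind (P *m A *m P^T) <= ind A)%N.
Proof.
move=> sA; have sB : (P *m A *m P^T)^T = P *m A *m P^T.
  by rewrite !trmx_mul trmxK sA mulmxA.
have [U nU] := neg_def_ex sB.
apply: (@neg_def_le _ _ _ (U *m toC P)) => // a /nU.
rewrite /hform !map_mxM !trmx_mul !map_mxM /= !mulmxA.
suff -> : toC P^T = (toC P)^*T by [].
by apply/matrixP => i j; rewrite !mxE; apply/esym/CrealP; rewrite complex_real.
Qed.

(** Rectangular congruences, one each way, let forms of different sizes be compared. *)
Lemma ind_congr p q (A : 'M[R]_p) (B : 'M[R]_q) P Q : A^T = A ->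
  A = P *m B *m P^T -> B = Q *m A *m Q^T -> ind A = ind B.
Proof.
move=> sA eA eB; have sB : B^T = B by rewrite eB !trmx_mul trmxK sA mulmxA.
apply/eqP; rewrite eqn_leq; apply/andP; split.
  by rewrite [X in (ind X <= _)%N]eA ind_congr_le.
by rewrite [X in (ind X <= _)%N]eB ind_congr_le.
Qed.

Lemma ind_congr_unit p (A P : 'M[R]_p) : A^T = A -> P \in unitmx ->
  ind (P *m A *m P^T) = ind A.
Proof.
move=> sA uP; apply: (@ind_congr _ _ _ _ P (invmx P)) => //.
  by rewrite !trmx_mul trmxK sA mulmxA.
by rewrite !mulmxA mulVmx // mul1mx trmx_inv -mulmxA mulmxV ?unitmx_tr ?mulmx1.
Qed.

Lemma ind_block_diag p q (A : 'M[R]_p) (B : 'M[R]_q) : A^T = A -> B^T = B ->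
  ind (block_mx A 0 0 B) = (ind A + ind B)%N.
Proof.
move=> /sym_spectral[_ [a [_ _ cA]]] /sym_spectral[_ [b [_ _ cB]]].
pose s k (c : 'rV[R]_k) := [seq c 0 i | i <- enum 'I_k].
have eq_s k (B' : 'M[R]_k) (c : 'rV_k) : char_poly B' = \prod_i ('X - (c 0 i)%:P) ->
    char_poly B' = \prod_(x <- s k c) ('X - x%:P) by rewrite big_map big_enum.
rewrite (ind_char_poly (eq_s _ _ _ cA)) (ind_char_poly (eq_s _ _ _ cB)).
rewrite -count_cat; apply: ind_char_poly.
by rewrite /char_poly char_block_diag_mx det_ublock big_cat /=; congr (_ * _); exact: eq_s.
Qed.

Lemma ind_scale p (A : 'M[R]_p) c : A^T = A -> 0 < c -> ind (c *: A) = ind A.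
Proof.
move=> sA c0; have cE : Num.sqrt c * Num.sqrt c = c by rewrite -expr2 sqr_sqrtr ?ltW.
have -> : c *: A = (Num.sqrt c)%:M *m A *m ((Num.sqrt c)%:M)^T.
  by rewrite tr_scalar_mx mul_scalar_mx mul_mx_scalar scalerA cE.
by rewrite ind_congr_unit // unitmxE det_scalar unitrX // unitfE sqrtr_eq0 -ltNge.
Qed.

(** The rank counts the nonzero eigenvalues; the positive ones become negative for [- A]. *)
Lemma rank_ind p (A : 'M[R]_p) : A^T = A -> (\rank A = ind A + ind (- A))%N.
Proof.
move=> sA; have [P [r [PP eA cA]]] := sym_spectral sA.
have uP : P \in unitmx by rewrite unitarymx_unit //; apply/unitarymxP.
have {}eA : P *m toC A = diag_mx (toC r) *m P.
  by rewrite -eA -!mulmxA (mulmx1C PP) mulmx1.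
have cN : char_poly (- A) = \prod_i ('X - ((- r) 0 i)%:P).
  apply: (char_poly_diag uP); rewrite !map_mxN mulmxN eA raddfN mulNmx //.
rewrite (ind_char_poly_card cA) (ind_char_poly_card cN).
have fP : row_full P by rewrite row_full_unit.
rewrite -(mxrank_map (real_complex R)) -(eqmxMfull (toC A) fP).
rewrite eA mxrankMfree ?row_free_unit // rank_diag_mx -cardUI [X in (_ = _ + X)%N]eq_card0.
  rewrite addn0; apply: eq_card => i; rewrite !inE !mxE oppr_lt0.
  by rewrite (fmorph_eq0 (real_complex R)) neq_lt.
by move=> i; rewrite !inE mxE oppr_lt0; case: ltgtP.
Qed.

End Inertia.

(** * Elimination in symmetric block matrices *)

Section BlockInertia.
Variable R : realType.

Lemma mul_Fmx p q (A : 'M[R]_(p, q)) : A *m Fmx A = 0.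
Proof. by case: (pinvP A) => e _ _ _; rewrite mulmxBr mulmx1 mulmxA e subrr. Qed.

Lemma mul_Emx p q (A : 'M[R]_(p, q)) : Emx A *m A = 0.
Proof. by case: (pinvP A) => e _ _ _; rewrite mulmxBl mul1mx e subrr. Qed.

Lemma tr_Fmx p q (A : 'M[R]_(p, q)) : (Fmx A)^T = Fmx A.
Proof. by case: (pinvP A) => _ _ _ e; rewrite raddfB /= trmx1 e. Qed.

Lemma tr_Emx p q (A : 'M[R]_(p, q)) : (Emx A)^T = Emx A.
Proof. by case: (pinvP A) => _ _ e _; rewrite raddfB /= trmx1 e. Qed.

Lemma Fmx_idem p q (A : 'M[R]_(p, q)) : Fmx A *m Fmx A = Fmx A.
Proof. by rewrite {1}/Fmx mulmxBl mul1mx -mulmxA mul_Fmx mulmx0 subr0. Qed.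

Lemma pinv_Emx p q (A : 'M[R]_(p, q)) : pinv A *m Emx A = 0.
Proof. by case: (pinvP A) => _ e _ _; rewrite mulmxBr mulmx1 mulmxA e subrr. Qed.

Lemma trmxN p q (A : 'M[R]_(p, q)) : (- A)^T = - A^T.
Proof. by rewrite raddfN. Qed.

Lemma trmxB p q (A B : 'M[R]_(p, q)) : (A - B)^T = A^T - B^T.
Proof. by rewrite raddfB. Qed.

Lemma unitmxN p (A : 'M[R]_p) : (- A \in unitmx) = (A \in unitmx).
Proof. by rewrite -scaleN1r unitmxZ ?unitrN1. Qed.

Lemma Emx_idem p q (A : 'M[R]_(p, q)) : Emx A *m Emx A = Emx A.
Proof. by rewrite {2}/Emx mulmxBr mulmx1 mulmxA mul_Emx mul0mx subr0. Qed.

(** A column operation projects [B] off the column space of [A]. The result is fixed by [Emx A],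
    which kills [A], so the two column spaces are independent. *)
Lemma rank_row_mx_E p q r (A : 'M[R]_(p, q)) (B : 'M[R]_(p, r)) :
  \rank (row_mx A B) = (\rank A + \rank (Emx A *m B))%N.
Proof.
pose P := block_mx 1%:M (- (pinv A *m B)) 0 1%:M : 'M[R]_(q + r).
have fP : row_free P by rewrite row_free_unit unitmxE det_ublock !det1 mulr1 unitr1.
have eP : row_mx A B *m P = row_mx A (Emx A *m B).
  rewrite mul_row_block !mulmx1 mulmx0 addr0 mulmxN mulmxBl mul1mx mulmxA.
  by rewrite addrC.
rewrite -(mxrankMfree _ fP) eP -mxrank_tr tr_row_mx -addsmxE.
rewrite mxrank_disjoint_sum ?mxrank_tr //.
apply/eqP/rowV0P => v; rewrite sub_capmx => /andP[/submxP[a va] /submxP[b vb]].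
have vE : v *m Emx A = v.
  by rewrite vb trmx_mul tr_Emx !mulmxA -(mulmxA _ (Emx A)) Emx_idem.
by rewrite -vE va -mulmxA -(tr_Emx A) -trmx_mul mul_Emx trmx0 mulmx0.
Qed.

Lemma sym_block p q (A : 'M[R]_p) (B : 'M[R]_(p, q)) (D : 'M[R]_q) :
  A^T = A -> D^T = D -> (block_mx A B B^T D)^T = block_mx A B B^T D.
Proof. by move=> sA sD; rewrite tr_block_mx sA sD trmxK. Qed.

(** A sign change of the first block is a congruence of [S] with [- S], so the index is half the
    rank of [S]. *)
Lemma ind_offdiag p q (B : 'M[R]_(p, q)) : ind (block_mx 0 B B^T 0) = \rank B.
Proof.
have sS := sym_block B (trmx0 R p p) (trmx0 R q q).
set S := block_mx _ _ _ _ in sS *.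
have indN : ind (- S) = ind S.
  have eN : - S = block_mx (- 1%:M) 0 0 1%:M *m S *m (block_mx (- 1%:M) 0 0 1%:M)^T.
    rewrite tr_block_mx !mulmx_block opp_block_mx !(raddf0, raddfN) /= !trmx1.
    by rewrite !(mul0mx, mulmx0, mul1mx, mulmx1, mulNmx, mulmxN, addr0, add0r, oppr0).
  rewrite eN ind_congr_unit // unitmxE det_ublock det1 mulr1 -scaleN1r detZ det1 mulr1.
  by rewrite unitrX // unitrN1.
pose J : 'M[R]_(q + p, p + q) := block_mx 0 1%:M 1%:M 0.
have fJ : row_free J.
  apply/row_freeP; exists (block_mx 0 1%:M 1%:M 0); rewrite /J mulmx_block.
  by rewrite !(mul0mx, mulmx0, mul1mx, mulmx1, addr0, add0r) -scalar_mx_block.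
have : \rank S = (\rank B + \rank B)%N.
  rewrite -{2}(mxrank_tr B) -rank_diag_block_mx -(mxrankMfree _ fJ).
  by rewrite mulmx_block !(mul0mx, mulmx0, mul1mx, mulmx1, addr0, add0r).
rewrite (rank_ind sS) indN !addnn => /(congr1 half); by rewrite !doubleK.
Qed.

(** [B] eliminates all of [D] except its restriction to the kernel of [B]; this restriction then
    splits off from the hyperbolic part. *)
Lemma ind_block0 p q (B : 'M[R]_(p, q)) (D : 'M[R]_q) : D^T = D ->
  ind (block_mx 0 B B^T D) = (\rank B + ind (Fmx B *m D *m Fmx B))%N.
Proof.
move=> sD.
(* [F] and [G] are the complementary orthogonal projections onto the kernel and the row space of
   [B]. *)
have [F eF] : exists F, F = Fmx B by eexists.
have [G eG] : exists G, G = pinv B *m B by eexists.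
have FG : F + G = 1%:M by rewrite eF eG subrK.
have tG : G^T = G by rewrite eG; case: (pinvP B).
have tF : F^T = F by rewrite eF tr_Fmx.
have BF : B *m F = 0 by rewrite eF mul_Fmx.
have FF : F *m F = F by rewrite eF Fmx_idem.
have FG0 : F *m G = 0.
  by rewrite -[G]addr0 -(subrr F) addrA (addrC G) FG mulmxBr mulmx1 FF subrr.
have GF0 : G *m F = 0 by rewrite -tF -tG -trmx_mul FG0 trmx0.
have BG : B *m G = B by rewrite eG mulmxA; case: (pinvP B).
have FB : F *m B^T = 0 by rewrite -tF -trmx_mul BF trmx0.
have GB : G *m B^T = B^T by rewrite -tG -trmx_mul BG.
rewrite -eF.
(* The symmetric term [G *m D *m G] is shared equally by [L *m B] and its transpose, hence the
   factor 1/2. *)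
pose L := (F *m D + (2%:R)^-1 *: (G *m D)) *m pinv B.
have sFDF : (F *m D *m F)^T = F *m D *m F by rewrite !trmx_mul sD tF mulmxA.
have LB : D - L *m B - B^T *m L^T = F *m D *m F.
  have e1 : L *m B = F *m D *m G + 2%:R^-1 *: (G *m D *m G).
    by rewrite /L -mulmxA -eG mulmxDl -scalemxAl.
  have e2 : B^T *m L^T = G *m D *m F + 2%:R^-1 *: (G *m D *m G).
    by rewrite -trmx_mul e1 raddfD /= linearZ /= !trmx_mul sD tF tG !mulmxA.
  have e3 : D = F *m D *m F + F *m D *m G + (G *m D *m F + G *m D *m G).
    by rewrite -!mulmxDr -mulmxDl FG !mulmx1 -mulmxDl FG mul1mx.
  have e4 : G *m D *m G = 2%:R^-1 *: (G *m D *m G) + 2%:R^-1 *: (G *m D *m G).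
    rewrite -scalerDl [_ + _](_ : _ = 1) ?scale1r //; lra.
  rewrite e1 e2 {1}e3 {1}e4; set x := F *m D *m F; set y := F *m D *m G.
  set z := G *m D *m F; set h := 2%:R^-1 *: _.
  by apply/matrixP => i j; move: x y z h => x y z h; rewrite !mxE; ring.
have -> : ind (block_mx 0 B B^T D) = ind (block_mx 0 B B^T (F *m D *m F)).
  pose P := block_mx 1%:M 0 (- L) 1%:M : 'M[R]_(p + q).
  have -> : block_mx 0 B B^T (F *m D *m F) = P *m block_mx 0 B B^T D *m P^T.
    rewrite /P tr_block_mx !mulmx_block !(raddf0, raddfN) /= !trmx1.
    rewrite !(mul0mx, mulmx0, mul1mx, mulmx1, mulNmx, mulmxN, addr0, add0r, oppr0).
    by rewrite -LB; congr block_mx; rewrite addrC (addrC _ D).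
  by rewrite ind_congr_unit ?sym_block ?trmx0 // unitmxE det_lblock !det1 mulr1 unitr1.
rewrite -(ind_offdiag B) -(ind_block_diag _ sFDF) ?sym_block ?trmx0 //.
(* The orthogonal sum has a second copy of the last component: on row vectors, one congruence
   duplicates it and the other combines the copies through [G] and [F]. *)
apply: (@ind_congr _ _ _ _ _ (row_mx 1%:M (col_mx 0 1%:M))
   (col_mx (block_mx 1%:M 0 0 G) (row_mx 0 F))); rewrite ?sym_block ?trmx0 //.
- rewrite tr_row_mx tr_col_mx !(trmx0, trmx1) mul_row_block.
  rewrite !(mulmx0, mul0mx, mul1mx, add0r, addr0).
  rewrite mul_row_col mulmx1 mul_col_mx mul0mx mul1mx mul_col_row.
  by rewrite !(mulmx0, mul0mx, mulmx1) add_block_mx !(addr0, add0r).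
- rewrite tr_col_mx tr_row_mx tr_block_mx !(trmx0, trmx1) mul_col_mx mul_col_row.
  rewrite tG tF !mulmx_block !mul_row_block !mul_block_col !mul_row_col.
  rewrite !(mulmx0, mul0mx, mul1mx, mulmx1, addr0, add0r) !mulmxA BG BF GB GF0 FB FF.
  by rewrite -!(mulmxA _ F) FG0 FF !(mul0mx, mulmx0) col_mx0 row_mx0.
Qed.

(** The two multipliers between [A] and [B] give congruences. This is what lets [Mtilde] be replaced
    by [Mmx]. *)
Lemma ind_block0_eqmx p p' q (A : 'M[R]_(p, q)) (B : 'M[R]_(p', q)) (D : 'M[R]_q) :
  D^T = D -> (A :=: B)%MS ->
  ind (block_mx 0 A A^T D) = ind (block_mx 0 B B^T D).
Proof.
move=> sD eAB.
have [M eA] : exists M, A = M *m B by apply/submxP; rewrite eAB.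
have [M' eB] : exists M', B = M' *m A by apply/submxP; rewrite eAB.
by apply: (@ind_congr _ _ _ _ _ (block_mx M 0 0 1%:M) (block_mx M' 0 0 1%:M));
  rewrite ?sym_block ?trmx0 // tr_block_mx !(trmx0, trmx1) !mulmx_block
    !(mulmx0, mul0mx, mul1mx, mulmx1, addr0, add0r) -?trmx_mul -?eA -?eB -?trmx_mul.
Qed.

Lemma pinv_tr p q (A : 'M[R]_(p, q)) : pinv A^T = (pinv A)^T.
Proof.
apply/esym/pinv_uniq; case: (pinvP A) => e1 e2 e3 e4; split.
- by rewrite -!trmx_mul mulmxA e1.
- by rewrite -!trmx_mul mulmxA e2.
- by rewrite -!trmx_mul e4.
- by rewrite -!trmx_mul e3.
Qed.

Lemma pinv_opp p q (A : 'M[R]_(p, q)) : pinv (- A) = - pinv A.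
Proof.
apply/esym/pinv_uniq; case: (pinvP A) => e1 e2 e3 e4.
by split; rewrite ?(mulNmx, mulmxN, opprK) ?e1 ?e2.
Qed.

(** A Schur complement for a possibly singular pivot: the pseudoinverse leaves the remainder
    [Emx A *m B], orthogonal to the range of [A], so [A] splits off. *)
Lemma ind_block_schur p q (A : 'M[R]_p) (B : 'M[R]_(p, q)) (D : 'M[R]_q) :
  A^T = A -> D^T = D ->
  ind (block_mx A B B^T D) = (ind A +
    ind (block_mx 0 (Emx A *m B) (Emx A *m B)^T (D - B^T *m pinv A *m B)))%N.
Proof.
move=> sA sD.
have [G eG] : exists G, G = pinv A by eexists.
have tG : G^T = G by rewrite eG -pinv_tr sA.
have [e1 e2 e3 _] := pinvP A; rewrite -eG in e1 e2 e3.
have AG : A *m G = G *m A by rewrite -e3 trmx_mul tG sA.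
have [F eF] : exists F, F = Emx A by eexists.
have tF : F^T = F by rewrite eF tr_Emx.
have FA : F *m A = 0 by rewrite eF mul_Emx.
have AF : A *m F = 0 by rewrite -sA -tF -trmx_mul FA trmx0.
have eF' : F = 1%:M - A *m G by rewrite eF eG.
have GF : G *m F = 0 by rewrite eF eG pinv_Emx.
have FF : F *m F = F by rewrite {1}eF' mulmxBl mul1mx -mulmxA GF mulmx0 subr0.
have [X eX] : exists X, X = F *m B by eexists.
rewrite -eF -eG -eX; set Q := D - _.
have sQ : Q^T = Q by rewrite /Q raddfB /= sD !trmx_mul tG trmxK mulmxA.
have -> : ind (block_mx A B B^T D) = ind (block_mx A X X^T Q).
  pose P := block_mx 1%:M 0 (- (B^T *m G)) 1%:M : 'M[R]_(p + q).
  have -> : block_mx A X X^T Q = P *m block_mx A B B^T D *m P^T.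
    rewrite /P tr_block_mx !mulmx_block !(raddf0, raddfN) /= !trmx1 trmx_mul tG trmxK.
    rewrite !(mul0mx, mulmx0, mul1mx, mulmx1, mulNmx, mulmxN, addr0, add0r, oppr0).
    congr block_mx.
    + by rewrite eX eF' mulmxBl mul1mx mulmxA addrC.
    + by rewrite eX trmx_mul tF eF' mulmxBr mulmx1 AG mulmxA addrC.
    + rewrite /Q mulmxDl mulNmx -!mulmxA (mulmxA A) (mulmxA G (A *m G)).
      by rewrite (mulmxA G A) e2 addNr oppr0 add0r addrC.
  by rewrite ind_congr_unit ?sym_block // unitmxE det_lblock !det1 mulr1 unitr1.
rewrite -ind_block_diag ?sym_block ?trmx0 //.
apply: (@ind_congr _ _ _ _ _ (row_mx (col_mx 1%:M 0) 1%:M)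
   (col_mx (row_mx (A *m G) 0) (block_mx F 0 0 1%:M))); rewrite ?sym_block ?trmx0 //.
- rewrite tr_row_mx tr_col_mx !(trmx0, trmx1) mul_row_block.
  rewrite !(mulmx0, mul0mx, mul1mx, add0r, addr0).
  rewrite mul_row_col mulmx1 mul_col_mx mul0mx mul1mx mul_col_row.
  by rewrite !(mulmx0, mul0mx, mulmx1) add_block_mx !(addr0, add0r).
have XF : F *m X = X by rewrite eX mulmxA FF.
have GX : G *m X = 0 by rewrite eX mulmxA GF mul0mx.
have FX : X^T *m F = X^T by rewrite -{1}tF -trmx_mul XF.
have AGX : A *m G *m X = 0 by rewrite -mulmxA GX mulmx0.
have XAG : X^T *m (A *m G) = 0 by rewrite -e3 -trmx_mul AGX trmx0.
have AGAG : A *m G *m A *m (A *m G) = A by rewrite e1 AG mulmxA e1.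
rewrite tr_col_mx tr_row_mx tr_block_mx !(trmx0, trmx1) mul_col_mx mul_col_row.
rewrite e3 tF !mulmx_block !mul_row_block !mul_block_col !mul_row_col.
rewrite !(mulmx0, mul0mx, mul1mx, mulmx1, addr0, add0r) AGAG FA XF FX AGX XAG.
by rewrite e1 AF !mul0mx row_mx0 col_mx0.
Qed.

Lemma ind_castmx p q (e : p = q) (A : 'M[R]_p) : ind (castmx (e, e) A) = ind A.
Proof. by case: _ / e. Qed.

(** The pivot is formed by the first two block rows and columns; its index is [\rank w] and its
    pseudoinverse is explicit. The remainders [- (Emx w *m N)] and [Fmx w *m K] have the same row
    space, so one of them suffices. *)
Lemma ind_schur3 p q (w : 'M[R]_p) (N K : 'M[R]_(p, q)) (D : 'M[R]_q) :
  D^T = D -> (Emx w *m N :=: Fmx w *m K)%MS ->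
  ind (block_mx 0 (- row_mx w N) (- row_mx w N)^T (block_mx 0 K K^T D)) =
  (\rank w + ind (block_mx 0 (Emx w *m N) (Emx w *m N)^T
    (D - K^T *m pinv w *m N - (K^T *m pinv w *m N)^T)))%N.
Proof.
move=> sD eX.
pose A := block_mx 0 (- w) (- w)^T 0 : 'M[R]_(p + p).
pose B := col_mx (- N) K.
have sA : A^T = A by rewrite sym_block ?trmx0.
have -> : ind (block_mx 0 (- row_mx w N) (- row_mx w N)^T (block_mx 0 K K^T D)) =
    ind (block_mx A B B^T D).
  rewrite opp_row_mx tr_row_mx block_mxA ind_castmx /A /B.
  by rewrite tr_col_mx.
have pA : pinv A = block_mx 0 (- (pinv w)^T) (- pinv w) 0.
  have [e1 e2 e3 e4] := pinvP w.
  apply/esym/pinv_uniq; rewrite /A raddfN /=.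
  have f : w^T *m (pinv w)^T = pinv w *m w by rewrite -trmx_mul e4.
  have g : (pinv w)^T *m w^T = w *m pinv w by rewrite -trmx_mul e3.
  split; rewrite !mulmx_block
    !(mul0mx, mulmx0, mulNmx, mulmxN, opprK, addr0, add0r) ?tr_block_mx ?trmx0 ?f ?g ?e3 ?e4 //.
  - by rewrite oppr0 e1 -{1}e4 -trmx_mul mulmxA e1.
  - by rewrite oppr0 e2 -{1}e3 -trmx_mul mulmxA e2.
rewrite (ind_block_schur _ sA sD); congr (_ + _)%N.
  by rewrite ind_offdiag eqmx_opp.
have -> : Emx A *m B = col_mx (- (Emx w *m N)) (Fmx w *m K).
  have [_ _ _ e4] := pinvP w.
  rewrite /Emx /Fmx pA /A /B raddfN /= mulmx_block !mulNmx !mulmxN !mul0mx !mulmx0 !opprK.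
  rewrite !oppr0 !add0r !addr0 -trmx_mul e4 !mulmxBl !mul1mx mul_block_col.
  rewrite !mul0mx !addr0 !add0r.
  by rewrite opp_col_mx add_col_mx mulmxN opprK opprB addrC.
have -> : D - B^T *m pinv A *m B =
    D - K^T *m pinv w *m N - (K^T *m pinv w *m N)^T.
  rewrite pA /B tr_col_mx mul_row_block !mulmx0 add0r addr0 mul_row_col raddfN /=.
  rewrite !(mulmxN, mulNmx) !opprK !trmx_mul trmxK !mulmxA.
  by rewrite raddfN /= !mulNmx opprK opprD addrA.
apply: ind_block0_eqmx.
  rewrite !raddfB /= trmxK sD; set Z := _ *m N; by rewrite addrAC.
apply: eqmx_trans (eqmx_sym (addsmxE _ _)) _.
apply: eqmx_trans (adds_eqmx (eqmx_opp _) (eqmx_sym eX)) _.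
exact/addsmx_idPl.
Qed.

End BlockInertia.

(** * Lagrangian frames and charts *)

Section Lagrangian.
Variables (R : realType) (n : nat).
Implicit Types Y Z : 'M[R]_(n + n, n).

Lemma wronE Y Z :
  wron Y Z = (usubmx Y)^T *m dsubmx Z - (dsubmx Y)^T *m usubmx Z.
Proof.
rewrite /wron /Jmx -{1}[Y]vsubmxK -{1}[Z]vsubmxK tr_col_mx mul_row_block mul_row_col.
by rewrite !mulmx0 mulmxN !mulmx1 add0r addr0 mulNmx addrC.
Qed.

Lemma wron_tr Y Z : (wron Y Z)^T = - wron Z Y.
Proof. by rewrite !wronE raddfB /= !trmx_mul !trmxK opprB. Qed.

Lemma wronNl Y Z : wron (- Y) Z = - wron Y Z.
Proof. by rewrite /wron raddfN /= !mulNmx. Qed.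

Lemma Jmx_unit : Jmx R n \in unitmx.
Proof.
apply: (@mulmx1_unit _ _ (Jmx R n) (- Jmx R n) _).1.
rewrite /Jmx opp_block_mx mulmx_block.
rewrite !(mulmx0, mul0mx, mulNmx, mulmxN, mul1mx, oppr0, addr0, add0r, opprK).
by rewrite -scalar_mx_block.
Qed.

(** The [Jmx]-orthogonal complement of the column space of [Y] contains that space and has the same
    dimension n. *)
Lemma lagrangian_max Y q (z : 'M[R]_(n + n, q)) : frame Y ->
  Y^T *m Jmx R n *m z = 0 -> exists b, z = Y *m b.
Proof.
move=> [YY rY] Yz.
set A := (Y^T *m Jmx R n)^T.
have YA : Y^T *m A = 0 by rewrite -trmx_mul -/(wron Y Y) YY trmx0.
have rA : \rank A = n.
  by rewrite mxrank_tr mxrankMfree ?row_free_unit ?Jmx_unit // mxrank_tr.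
have sub : (Y^T <= kermx A)%MS by apply/sub_kermxP.
have eq : (kermx A <= Y^T)%MS.
  by rewrite -(geq_leqif (mxrank_leqif_sup sub)) mxrank_ker rA mxrank_tr rY addnK.
have : (z^T <= Y^T)%MS.
  by apply: submx_trans eq; apply/sub_kermxP; rewrite -trmx_mul Yz trmx0.
by case/submxP => b eb; exists b^T; apply: trmx_inj; rewrite trmx_mul trmxK.
Qed.

(** The hypothesis puts [K] in the column space of [wron Y1 Y2], so [z] can be moved along [Y2]
    until it is orthogonal to [Y1], hence a combination of [Y1]. The form with [Y2] does not see the
    move. *)
Lemma frame_EF_ker Y1 Y2 q (z : 'M[R]_(n + n, q)) : frame Y1 -> frame Y2 ->
  Fmx (wron Y2 Y1) *m (Y1^T *m Jmx R n *m z) = 0 ->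
  Emx (wron Y2 Y1) *m (Y2^T *m Jmx R n *m z) = 0.
Proof.
move=> fY1 fY2; set w := wron Y2 Y1; set K := _ *m z => FK.
have [_ _ _ e4] := pinvP w.
have eK : K = - wron Y1 Y2 *m ((pinv w)^T *m K).
  rewrite -wron_tr mulmxA -trmx_mul e4.
  by move/eqP: FK; rewrite mulmxBl mul1mx subr_eq0 => /eqP.
have [|b eb] := lagrangian_max (z := z + Y2 *m ((pinv w)^T *m K)) fY1.
  by rewrite mulmxDr -/K mulmxA -/(wron Y1 Y2) {1}eK mulNmx addNr.
have -> : Y2^T *m Jmx R n *m z = w *m b.
  have : Y2^T *m Jmx R n *m (z + Y2 *m ((pinv w)^T *m K)) = w *m b.
    by rewrite eb mulmxA.
  by rewrite mulmxDr (mulmxA _ Y2) -/(wron Y2 Y2) fY2.1 mul0mx addr0.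
by rewrite mulmxA mul_Emx mul0mx.
Qed.

Lemma Emx_wronC Y1 Y2 : Emx (wron Y1 Y2) = Fmx (wron Y2 Y1).
Proof.
have -> : wron Y1 Y2 = - (wron Y2 Y1)^T by rewrite wron_tr opprK.
have [_ _ _ e4] := pinvP (wron Y2 Y1).
by rewrite /Emx /Fmx pinv_opp pinv_tr mulNmx mulmxN opprK -trmx_mul e4.
Qed.

(** Inclusion of row spaces is tested on cokernels, and [frame_EF_ker] applies in both orders of the
    frames. This is the link between [Mtilde] and [Mmx]. *)
Lemma frame_EF_eqmx Y1 Y2 q (z : 'M[R]_(n + n, q)) : frame Y1 -> frame Y2 ->
  (Emx (wron Y2 Y1) *m (Y2^T *m Jmx R n *m z) :=:
   Fmx (wron Y2 Y1) *m (Y1^T *m Jmx R n *m z))%MS.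
Proof.
move=> f1 f2; apply/eqmxP/andP; split; rewrite submxE; apply/eqP.
  set c := cokermx _; have := frame_EF_ker (z := z *m c) f1 f2.
  by rewrite !(mulmxA _ z) !(mulmxA _ _ c); apply; rewrite mulmx_coker.
set c := cokermx _; have := frame_EF_ker (z := z *m c) f2 f1.
rewrite Emx_wronC -Emx_wronC !(mulmxA _ z) !(mulmxA _ _ c).
by apply; rewrite mulmx_coker.
Qed.

(* If v (U - t X)^T = 0 for a polynomial vector v, comparing coefficients from
   the top shows that each coefficient a of v satisfies a X^T = 0 and
   a U^T = b X^T for some b, and symmetry of X^T U then forces a U^T = 0. *)
Lemma frame_pencil_det Y : frame Y ->
  \det (map_mx polyC (dsubmx Y) - 'X *: map_mx polyC (usubmx Y)) != 0.
Proof.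
move=> [YY rY]; set X := usubmx Y; set U := dsubmx Y.
have sXU : X^T *m U = U^T *m X.
  by apply/eqP; rewrite -subr_eq0 -wronE YY.
apply/negP; rewrite -det_tr => /det0P[v v0 ev].
pose a k : 'rV[R]_n := \row_j (v 0 j)`_k.
have rec k : a k *m U^T = (if k is k'.+1 then a k' else 0) *m X^T.
  apply/rowP => i; have /rowP/(_ i)/(congr1 (fun p : {poly R} => p`_k)) := ev.
  rewrite !mxE coef_sum coef0 => e.
  apply/eqP; rewrite -subr_eq0 -sumrB; apply/eqP; rewrite -[RHS]e.
  apply: eq_bigr => j _; rewrite !mxE mulrBr coefB coefMC mulrCA coefXM.
  by case: k {e} => [|k] /=; rewrite ?mxE ?mul0r // coefMC.
have step k : a k.+1 = 0 -> a k = 0.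
  move=> e; have aX : a k *m X^T = 0 by rewrite -(rec k.+1) e mul0mx.
  have aU : a k *m U^T = 0.
    apply/eqP; rewrite -trmx_eq0; apply/eqP; set u := (_ *m _)^T.
    have : u^T *m u = 0.
      rewrite /u trmxK {1}rec trmx_mul trmxK mulmxA -(mulmxA _ X^T) sXU.
      by rewrite mulmxA -mulmxA -(trmxK X) -trmx_mul aX trmx0 mulmx0.
    move/matrixP/(_ 0 0); rewrite !mxE => /eqP.
    rewrite psumr_eq0 => [/allP u0|i _]; last by rewrite [_^T _ _]mxE -expr2 sqr_ge0.
    apply/colP => i; have := u0 i (mem_index_enum _).
    by rewrite [_^T _ _]mxE -expr2 sqrf_eq0 => /eqP ->; rewrite mxE.
  have fY : row_free Y^T by rewrite /row_free mxrank_tr rY.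
  apply: (row_free_inj fY).
  by rewrite mul0mx -[Y]vsubmxK tr_col_mx mul_mx_row aX aU row_mx0.
have [K aK] : exists K, forall k, (K <= k)%N -> a k = 0.
  exists (\max_(i < n) size (v 0%R i)) => k Kk; apply/rowP => i.
  rewrite !mxE nth_default //; apply: leq_trans Kk.
  exact: (leq_bigmax (F := fun i => size (v 0 i))).
have a0 k : a k = 0.
  have : a (k + K)%N = 0 by rewrite aK ?leq_addl.
  by elim: K {aK} => [|K IH]; rewrite ?addn0 // addnS => /step/IH.
move/negP: v0; apply; apply/eqP/rowP => i; apply/polyP => k.
by have /rowP/(_ i) := a0 k; rewrite !mxE coef0.
Qed.

(* (C, -X) are the blocks of Y in a symplectic basis adapted to the plane
   (I; t I), and Q is the slope matrix of Y in that basis. *)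
Definition chartC (t : R) Y := dsubmx Y - t *: usubmx Y.
Definition chartQ (t : R) Y := - usubmx Y *m invmx (chartC t Y).

(** Each frame excludes only the roots of one nonzero polynomial. The roots of the product lie
    strictly inside its [cauchy_bound], so this bound is an admissible [t]. *)
Lemma chart_ex (I : finType) (Y : I -> 'M[R]_(n + n, n)) :
  (forall i, frame (Y i)) -> exists t, forall i, chartC t (Y i) \in unitmx.
Proof.
move=> fY; pose p i :=
  \det (map_mx polyC (dsubmx (Y i)) - 'X *: map_mx polyC (usubmx (Y i))).
have p0 : \prod_i p i != 0 by apply/prodf_neq0 => i _; apply: frame_pencil_det.
exists (cauchy_bound (\prod_i p i)) => i.
have : ~~ root (\prod_i p i) (cauchy_bound (\prod_i p i)).
  by apply/negP => /(root_in_cauchy_bound p0); rewrite in_itv /= ltxx andbF.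
rewrite rootE horner_prod => /prodf_neq0/(_ i isT).
rewrite unitmxE unitfE; congr (_ != 0).
rewrite -horner_evalE -det_map_mx; congr (\det _).
by apply/matrixP => j k; rewrite !mxE /= /horner_eval !hornerE.
Qed.

(** The transpose on [chartQ t Y] stays because the symmetry lemma [chartQ_sym] is deduced from this
    identity at [Z = Y]. *)
Lemma wron_chart t Y Z : chartC t Y \in unitmx -> chartC t Z \in unitmx ->
  wron Y Z = (chartC t Y)^T *m (chartQ t Z - (chartQ t Y)^T) *m chartC t Z.
Proof.
move=> uY uZ; rewrite (mulmxBr (chartC t Y)^T) mulmxBl /chartQ trmx_mul trmx_inv.
rewrite !mulmxA mulmxKV // mulmxV ?unitmx_tr // mul1mx.
rewrite wronE /chartC !(raddfN, raddfB) /= !(mulmxBl, mulmxBr, mulmxN, mulNmx).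
rewrite [(t *: _)^T]linearZ /= -scalemxAl -scalemxAr !opprK.
by rewrite opprB [RHS]addrC addrA subrK.
Qed.

Lemma chartQ_sym t Y : wron Y Y = 0 -> chartC t Y \in unitmx ->
  (chartQ t Y)^T = chartQ t Y.
Proof.
move=> YY uY; move: (wron_chart uY uY); rewrite YY => /esym/eqP.
rewrite -(mul0mx _ (chartC t Y)) => /eqP/(can_inj (mulmxK uY))/eqP.
rewrite -(mulmx0 _ (chartC t Y)^T) => /eqP/(can_inj (mulKmx _)) e.
by apply/eqP; rewrite eq_sym -subr_eq0 e // unitmx_tr.
Qed.

Definition vert : 'M[R]_(n + n, n) := col_mx 0 1%:M.

Lemma frame_vert : frame vert.
Proof.
split; first by rewrite wronE !col_mxKu !col_mxKd trmx0 mul0mx mulmx0 subrr.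
by rewrite rank_col_0mx mxrank1.
Qed.

(** The upper block in the comparative index is thus, up to sign, a Wronskian with the vertical
    plane. *)
Lemma wron_vertl Y : wron vert Y = - usubmx Y.
Proof. by rewrite wronE col_mxKu col_mxKd trmx0 mul0mx trmx1 mul1mx add0r. Qed.

Lemma frameN Y : frame Y -> frame (- Y).
Proof. by case=> YY rY; split; rewrite ?eqmx_opp // /wron mulmxN raddfN /= !mulNmx opprK. Qed.

Lemma chartCN t Y : chartC t (- Y) = - chartC t Y.
Proof. by rewrite /chartC [usubmx _]raddfN [dsubmx _]raddfN /= scalerN opprD. Qed.

Lemma chartQN t Y : chartC t Y \in unitmx -> chartQ t (- Y) = chartQ t Y.
Proof.
move=> uY; rewrite /chartQ chartCN raddfN /= opprK.
have -> : invmx (- chartC t Y) = - invmx (chartC t Y).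
  by rewrite -scaleN1r -[- invmx _]scaleN1r invmxZ ?unitmxZ ?unitrN1 // invrN1.
by rewrite mulmxN mulNmx.
Qed.

End Lagrangian.

(** * Cyclic block matrices *)

Section Cyclic.
Variables (R : realType) (n : nat).

Lemma ind_mxdiag k (p_ : 'I_k -> nat) (B : forall i, 'M[R]_(p_ i)) :
  (forall i, (B i)^T = B i) -> ind (\mxdiag_i B i) = (\sum_i ind (B i))%N.
Proof.
elim: k p_ B => [|k IH] p_ B sB.
  have sD : (\mxdiag_i B i)^T = \mxdiag_i B i.
    by rewrite tr_mxdiag; apply: eq_mxdiag => -[].
  rewrite [RHS]big_ord0; apply/eqP; rewrite -leqn0.
  have := rank_leq_row (\mxdiag_i B i); rewrite [X in (_ <= X)%N]big_ord0.
  by rewrite (rank_ind sD); apply: leq_trans; apply: leq_addr.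
rewrite mxdiag_recl ind_castmx ind_block_diag // ?big_ord_recl ?IH //.
by rewrite tr_mxdiag; apply: eq_mxdiag => i.
Qed.

Definition cyc_sgn (l i : nat) : R := if (i <= l)%N then 1 else -1.

(** As a function of [i], [cyc_sgn l'] jumps from 1 to -1 right after [l'], so differences of
    neighbouring values detect [l']. For [l = k] the next index is out of range, and the value at 0
    is added instead. *)
Lemma cyc_sgn_dual k l l' : (l <= k)%N -> (l' <= k)%N ->
  \sum_(i < k.+1) ((i == l :> nat)%:R - (i == l.+1 :> nat)%:R
     + ((l == k) && (i == 0 :> nat))%:R) * cyc_sgn l' i = 2 * (l == l')%:R.
Proof.
move=> lk l'k.
have pick x : \sum_(i < k.+1) (i == x :> nat)%:R * cyc_sgn l' i =
    if (x < k.+1)%N then cyc_sgn l' x else 0.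
  rewrite -(big_ord1_eq +%R (cyc_sgn l')) [RHS]big_mkcond.
  by apply: eq_bigr => i _; case: eqP; rewrite ?mul1r ?mul0r.
under eq_bigr => i _ do rewrite mulrDl mulrBl.
rewrite big_split /= sumrB !pick ltnS lk.
have [->|nlk] := eqVneq l k; last first.
  rewrite /= [X in _ + X]big1 ?addr0 => [|i _]; last by rewrite mul0r.
  have -> : (l.+1 < k.+1)%N by lia.
  rewrite /cyc_sgn; case: (ltngtP l l') => /=; lra.
rewrite /= pick ltnn /cyc_sgn /=.
case: (ltngtP k l') l'k => //= ? _; lra.
Qed.

Lemma cyc_sgn_sum k (D Q : nat -> 'M[R]_n) i j : (i <= j <= k)%N ->
  (forall l, (l < k)%N -> D l = Q l - Q l.+1) -> D k = Q k - Q 0%N ->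
  \sum_(l < k.+1) (cyc_sgn l i * cyc_sgn l j) *: D l = 2 *: (Q j - Q i).
Proof.
move=> /andP[ij jk] eD eDk.
rewrite -(big_mkord xpredT (fun l => (cyc_sgn l i * cyc_sgn l j) *: D l)).
(* The product of signs is 1 below [i], -1 from [i] up to [j], and 1 from [j] on; each range
   telescopes and the term [k] closes the cycle. *)
rewrite (big_cat_nat (n := i)) //=; last lia.
rewrite (big_cat_nat (m := i) (n := j)) //=; last lia.
rewrite (big_cat_nat (m := j) (n := k)) //= big_nat1.
have tel a b : (a <= b <= k)%N -> \sum_(a <= l < b) D l = Q a - Q b.
  move=> /andP[ab bk]; rewrite -opprB -telescope_sumr // -sumrN.
  by apply: eq_big_nat => l /andP[_ lb]; rewrite opprB eD // (leq_trans lb).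
have -> : \sum_(0 <= l < i) (cyc_sgn l i * cyc_sgn l j) *: D l = Q 0%N - Q i.
  rewrite -tel; last lia; apply: eq_big_nat => l /andP[_ li].
  rewrite /cyc_sgn (leqNgt i) (leqNgt j) li (leq_trans li ij) /=.
  by rewrite mulrNN mulr1 scale1r.
have -> : \sum_(i <= l < j) (cyc_sgn l i * cyc_sgn l j) *: D l = Q j - Q i.
  rewrite -opprB -tel; last lia; rewrite -sumrN; apply: eq_big_nat => l /andP[il lj].
  rewrite /cyc_sgn il (leqNgt j) lj /=.
  by rewrite mul1r scaleN1r.
have -> : \sum_(j <= l < k) (cyc_sgn l i * cyc_sgn l j) *: D l = Q j - Q k.
  rewrite -tel; last lia; apply: eq_big_nat => l /andP[jl lk].
  by rewrite /cyc_sgn jl (leq_trans ij jl) mulr1 scale1r.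
rewrite /cyc_sgn jk (leq_trans ij jk) mulr1 scale1r eDk scaler_nat.
by apply/matrixP => a b; rewrite !mxE; ring.
Qed.

Definition chart_form (C Q : nat -> 'M[R]_n) (i j : nat) : 'M[R]_n :=
  (C i)^T *m (Q j - Q i) *m C j.

(** [P] carries the diagonal sum to [2 *: (s *: S)], and [cyc_sgn_dual] supplies the left inverse
    [P'] for the way back; [ind_scale] removes the factor 2. *)
Lemma ind_cyclic k (C Q D : nat -> 'M[R]_n) s :
  (forall i, (i <= k)%N -> C i \in unitmx) ->
  (forall i, (i <= k)%N -> (Q i)^T = Q i) ->
  (forall l, (l < k)%N -> D l = Q l - Q l.+1) -> D k = Q k - Q 0%N ->
  ind (s *: \mxblock_(i < k.+1, j < k.+1)
    (if (i < j)%N then chart_form C Q i j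
     else if (j < i)%N then (chart_form C Q j i)^T else 0)) =
  (\sum_(l < k.+1) ind (s *: D l))%N.
Proof.
move=> uC sQ eD eDk; set S := \mxblock_(i, j) _.
have sD l : (l <= k)%N -> (s *: D l)^T = s *: D l.
  rewrite leq_eqVlt linearZ /= => /orP[/eqP ->|lk]; congr (_ *: _).
    by rewrite eDk raddfB /= !sQ.
  by rewrite eD // raddfB /= !sQ // ltnW.
rewrite -(ind_mxdiag (B := fun l : 'I_k.+1 => s *: D l)); last first.
  by move=> l; apply: sD; have := ltn_ord l.
set B := \mxdiag_l _.
pose P := \mxblock_(i < k.+1, l < k.+1) (cyc_sgn l i *: (C i)^T).
pose P' := \mxblock_(l < k.+1, i < k.+1) ((2^-1 *
  ((i == l :> nat)%:R - (i == l.+1 :> nat)%:R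
     + (((l : nat) == k) && (i == 0 :> nat))%:R)) *: invmx (C i)^T).
have eS : 2 *: (s *: S) = P *m B *m P^T.
  rewrite mul_mxblock_mxdiag tr_mxblock mul_mxblock scalerA -mul_scalar_mx.
  rewrite -mxdiagZ mul_mxdiag_mxblock; apply: eq_mxblock => i j.
  have term l : cyc_sgn l i *: (C i)^T *m (s *: D l) *m (cyc_sgn l j *: (C j)^T)^T =
      s *: ((C i)^T *m ((cyc_sgn l i * cyc_sgn l j) *: D l) *m C j).
    rewrite [(_ *: _^T)^T]linearZ /= trmxK -!scalemxAl -!scalemxAr -!scalemxAl !scalerA.
    by congr (_ *: _); ring.
  under [RHS]eq_bigr => l _ do rewrite term.
  rewrite -scaler_sumr -mulmx_suml -mulmx_sumr mul_scalar_mx [2 * s]mulrC -scalerA.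
  have ik : (i <= k)%N by have := ltn_ord i.
  have jk : (j <= k)%N by have := ltn_ord j.
  congr (_ *: _); rewrite /chart_form; case: ltngtP => ij.
  - by rewrite (cyc_sgn_sum (Q := Q)) ?(ltnW ij) //= -scalemxAr -scalemxAl.
  - under eq_bigr => l _ do rewrite mulrC.
    rewrite (cyc_sgn_sum (Q := Q)) ?(ltnW ij) //= -scalemxAr -scalemxAl.
    by rewrite !trmx_mul trmxK raddfB /= !sQ // mulmxA.
  - under eq_bigr => l _ do rewrite ij.
    by rewrite (cyc_sgn_sum (Q := Q)) ?leqnn //= subrr !scaler0 mulmx0 mul0mx.
have sB : B^T = B by rewrite tr_mxdiag; apply: eq_mxdiag => l; apply: sD; have := ltn_ord l.
have PP : P' *m P = 1%:M.
  rewrite mul_mxblock -mxdiagZ; apply: eq_mxblock => l l'.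
  have lk : (l <= k)%N by have := ltn_ord l.
  have l'k : (l' <= k)%N by have := ltn_ord l'.
  set beta := fun i : nat => (i == l :> nat)%:R - (i == l.+1 :> nat)%:R
     + (((l : nat) == k) && (i == 0 :> nat))%:R : R.
  have term (x : 'I_k.+1) :
      (2^-1 * beta x) *: invmx (C x)^T *m (cyc_sgn l' x *: (C x)^T) =
      (2^-1 * (beta x * cyc_sgn l' x)) *: 1%:M.
    rewrite -scalemxAl -scalemxAr scalerA mulVmx ?mulrA // unitmx_tr uC //.
    by have := ltn_ord x.
  rewrite (eq_bigr _ (fun x _ => term x)).
  rewrite -scaler_suml -mulr_sumr cyc_sgn_dual // mulKf ?pnatr_eq0 //.
  rewrite (inj_eq val_inj); case: (eqVneq l l') => [_|_]; last by rewrite scale0r.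
  by rewrite conform_mx_id scale1r.
rewrite -(@ind_scale _ _ (s *: S) 2) ?ltr0n //; last first.
  have -> : s *: S = 2^-1 *: (P *m B *m P^T) by rewrite -eS scalerK ?pnatr_eq0.
  by rewrite [LHS]linearZ /= !trmx_mul trmxK sB mulmxA.
apply: (@ind_congr _ _ _ _ _ P P') => //.
  by rewrite eS !trmx_mul trmxK sB mulmxA.
by rewrite eS -!mulmxA (mulmxA P') PP mul1mx -trmx_mul PP trmx1 mulmx1.
Qed.

End Cyclic.

(** * Eliminations for both signs of a form at once *)

Section Signed.
Variables (R : realType) (s : R).
Hypothesis hs : s = 1 \/ s = - 1.

Lemma ind_block0_sgn p q (B : 'M[R]_(p, q)) (D : 'M[R]_q) : D^T = D ->
  ind (s *: block_mx 0 B B^T D) = (\rank B + ind (s *: (Fmx B *m D *m Fmx B)))%N.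
Proof.
move=> sD; case: hs => ->; first by rewrite !scale1r ind_block0.
rewrite !scaleN1r opp_block_mx oppr0 -trmxN ind_block0; last by rewrite trmxN sD.
by rewrite mxrank_opp /Fmx pinv_opp mulNmx mulmxN opprK mulmxN mulNmx.
Qed.

(** Negating [w], [N], [K] and [D] together negates the block matrix and also [K^T *m pinv w *m N],
    so the case [s = -1] reduces to [ind_schur3]. *)
Lemma ind_schur3_sgn p q (w : 'M[R]_p) (N K : 'M[R]_(p, q)) (D : 'M[R]_q) X :
  D^T = D -> (Emx w *m N :=: Fmx w *m K)%MS ->
  X = Emx w *m N \/ X = Fmx w *m K ->
  ind (s *: block_mx 0 (- row_mx w N) (- row_mx w N)^T (block_mx 0 K K^T D)) =
  (\rank w + ind (s *: block_mx 0 X X^T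
    (D - K^T *m pinv w *m N - (K^T *m pinv w *m N)^T)))%N.
Proof.
move=> sD eX hX.
have eqX : (X :=: Emx w *m N)%MS by case: hX => -> //; apply: eqmx_sym.
set Q := D - _ - _.
have sQ : Q^T = Q by rewrite /Q !raddfB /= trmxK sD addrAC.
case: hs => ->.
  rewrite !scale1r (ind_schur3 sD eX); congr (_ + _)%N.
  exact: esym (ind_block0_eqmx sQ eqX).
have eqX' : (- X :=: Emx (- w) *m (- N))%MS.
  apply: eqmx_trans (eqmx_opp _) _; apply: eqmx_trans eqX _.
  by rewrite mulmxN /Emx pinv_opp mulNmx mulmxN opprK; apply/eqmx_sym/eqmx_opp.
have eN : (Emx (- w) *m (- N) :=: Fmx (- w) *m (- K))%MS.
  apply: eqmx_trans (eqmx_sym eqX') _; apply: eqmx_trans (eqmx_opp _) _.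
  apply: eqmx_trans eqX _; apply: eqmx_trans eX _.
  by rewrite mulmxN /Fmx pinv_opp mulNmx mulmxN opprK; apply/eqmx_sym/eqmx_opp.
have sD' : (- D)^T = - D by rewrite trmxN sD.
have sQ' : (- Q)^T = - Q by rewrite trmxN sQ.
have -> : -1 *: block_mx 0 (- row_mx w N) (- row_mx w N)^T (block_mx 0 K K^T D) =
    block_mx 0 (- row_mx (- w) (- N)) (- row_mx (- w) (- N))^T
      (block_mx 0 (- K) (- K)^T (- D)).
  by rewrite scaleN1r -opp_row_mx !opp_block_mx !oppr0 !trmxN.
have -> : -1 *: block_mx 0 X X^T Q = block_mx 0 (- X) (- X)^T (- Q).
  by rewrite scaleN1r opp_block_mx oppr0 trmxN.
have eQ : - D - (- K)^T *m pinv (- w) *m (- N) - ((- K)^T *m pinv (- w) *m (- N))^T = - Q.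
  by rewrite pinv_opp !trmxN !(mulNmx, mulmxN) !opprK trmxN /Q !opprD !opprK.
rewrite (ind_schur3 sD' eN) mxrank_opp eQ; congr (_ + _)%N.
exact: esym (ind_block0_eqmx sQ' eqX').
Qed.


End Signed.

(** * Block recursion for the matrices S *)

Section Smx.
Variables (R : realType) (n : nat).
Implicit Type Y : nat -> 'M[R]_(n + n, n).

Lemma mxrow_recl_const p l (B : 'I_l.+1 -> 'M[R]_(p, n)) :
  \mxrow_j B j = castmx (erefl, mxsize_recl)
    (row_mx (B ord0) (\mxrow_(j < l) B (lift ord0 j))).
Proof. exact: mxrow_recl. Qed.

Lemma Smx_recl Y a l :
  Smx Y a l.+1 = castmx (mxsize_recl, mxsize_recl)
    (block_mx 0 (\mxrow_(j < l) w Y a (a.+1 + j))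
       (\mxrow_(j < l) w Y a (a.+1 + j))^T (Smx Y a.+1 l)).
Proof.
rewrite /Smx mxblock_recul tr_mxrow; congr (castmx _ (block_mx _ _ _ _)).
- by apply: eq_mxrow => j /=; rewrite addn0 addSnnS.
- by apply: eq_mxcol => j /=; rewrite addn0 addSnnS.
- by apply: eq_mxblock => i j; rewrite !lift0 !ltnS !addSnnS.
Qed.

Lemma Smx_sym Y a l : (Smx Y a l)^T = Smx Y a l.
Proof.
rewrite tr_mxblock; apply: eq_mxblock => i j.
by case: ltngtP => // _; rewrite ?trmxK ?trmx0.
Qed.

Lemma ind_cast_block0 p q q' (e : q = q') s (B : 'M[R]_(p, q)) (D : 'M[R]_q) :
  ind (s *: block_mx 0 (castmx (erefl, e) B) (castmx (erefl, e) B)^T (castmx (e, e) D)) =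
  ind (s *: block_mx 0 B B^T D).
Proof. by case: _ / e. Qed.

Lemma ind_Smx_recl Y a l s : ind (s *: Smx Y a l.+1) =
  ind (s *: block_mx 0 (\mxrow_(j < l) w Y a (a.+1 + j))
       (\mxrow_(j < l) w Y a (a.+1 + j))^T (Smx Y a.+1 l)).
Proof.
by rewrite Smx_recl; move: (block_mx _ _ _ _) => A; case: _ / mxsize_recl.
Qed.

Lemma ind_Smx_recl2 Y a l s : ind (s *: Smx Y a l.+2) =
  ind (s *: block_mx 0 (row_mx (w Y a a.+1) (\mxrow_(j < l) w Y a (a.+2 + j)))
     (row_mx (w Y a a.+1) (\mxrow_(j < l) w Y a (a.+2 + j)))^T
     (block_mx 0 (\mxrow_(j < l) w Y a.+1 (a.+2 + j))
       (\mxrow_(j < l) w Y a.+1 (a.+2 + j))^T (Smx Y a.+2 l))).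
Proof.
rewrite ind_Smx_recl mxrow_recl_const [Smx Y a.+1 _]Smx_recl ind_cast_block0.
suff -> : \mxrow_(j < l) w Y a (a.+1 + lift ord0 j) = \mxrow_(j < l) w Y a (a.+2 + j).
  by rewrite addn0.
by apply: eq_mxrow => j; rewrite lift0 -addSnnS.
Qed.

(** The last block has size [\sum_(i < 1) n], not literally [n]; the congruence through [T]
    identifies the two sizes without a cast. *)
Lemma ind_Smx3 (Y : nat -> 'M[R]_(n + n, n)) s : ind (s *: Smx Y 0 3) =
  ind (s *: block_mx 0 (row_mx (w Y 0 1) (w Y 0 2)) (row_mx (w Y 0 1) (w Y 0 2))^T
     (block_mx 0 (w Y 1 2) (w Y 1 2)^T 0)).
Proof.
rewrite ind_Smx_recl2; set D := Smx Y 2 1.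
have D0 : D = 0.
  by rewrite -mxblock0; apply: eq_mxblock => i j; rewrite !ord1.
pose T : 'M[R]_(\sum_(i < 1) n, n) := \mxcol_(i < 1) 1%:M.
have rowT (B : nat -> 'M[R]_n) : (\mxrow_(j < 1) B j) *m T = B 0%N.
  by rewrite mul_mxrow_mxcol big_ord1 mulmx1.
have TT : T *m T^T = 1%:M.
  rewrite tr_mxcol mul_mxcol_mxrow -mxdiagZ; apply: eq_mxblock => i j.
  by rewrite !ord1 eqxx conform_mx_id trmx1 mulmx1.
rewrite D0; set N := \mxrow_j w Y 0 (2 + j); set K := \mxrow_j w Y 1 (2 + j).
have eN : N *m T = w Y 0 2 by rewrite /N (rowT (fun j => w Y 0 (2 + j))).
have eK : K *m T = w Y 1 2 by rewrite /K (rowT (fun j => w Y 1 (2 + j))).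
rewrite -eN -eK; move: (w Y 0 1) N K {eN eK} T TT {rowT} => W N K T TT.
pose G := block_mx 1%:M 0 0 (block_mx 1%:M 0 0 T^T) : 'M[R]_(n + (n + n), n + (n + _)).
pose A := block_mx 0 (row_mx W N) (row_mx W N)^T (block_mx 0 K K^T 0).
have sA : A^T = A by rewrite sym_block ?trmx0 // sym_block ?trmx0.
have GG : G^T *m G = 1%:M.
  rewrite /G !tr_block_mx !(trmx0, trmx1) trmxK !mulmx_block.
  by rewrite !(mulmx0, mul0mx, mulmx1, addr0, add0r) TT -!scalar_mx_block.
set B := block_mx 0 (row_mx _ (N *m T)) _ _.
have eB : B = G *m A *m G^T.
  rewrite /B /G /A !tr_block_mx !(trmx0, trmx1) trmxK !mulmx_block.
  rewrite !(mulmx0, mul0mx, mulmx1, mul1mx, addr0, add0r).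
  rewrite mul_row_block !(mulmx0, mul0mx, mulmx1, mul1mx, addr0, add0r).
  rewrite !tr_row_mx mul_block_col !(mulmx0, mul0mx, mulmx1, mul1mx, addr0, add0r).
  by rewrite !trmx_mul mulmx_block !(mulmx0, mul0mx, mulmx1, addr0, add0r).
rewrite -/A; apply: (@ind_congr _ _ _ (s *: A) (s *: B) G^T G).
- by rewrite linearZ /= sA.
- rewrite trmxK eB -scalemxAr -scalemxAl; congr (_ *: _).
  by rewrite !mulmxA GG mul1mx -mulmxA GG mulmx1.
- by rewrite eB -scalemxAr -scalemxAl.
Qed.

End Smx.

(** * The comparative index in a chart *)

Section ComparativeIndex.
Variables (R : realType) (n : nat) (s : R).
Hypothesis hs : s = 1 \/ s = - 1.
Implicit Types Y Z : 'M[R]_(n + n, n).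

(** [T] annihilates [ciM Y Z], which forces the upper block of [Z *m T] into the column space of
    that of [Y]. Then [ciP Y Z] is a difference of two terms, symmetric because [Y] and [Z] are
    isotropic. *)
Lemma ciP_sym Y Z : frame Y -> frame Z -> (ciP Y Z)^T = ciP Y Z.
Proof.
move=> fY fZ; have [[YY _] [ZZ _]] := (fY, fZ).
have symXU W : wron W W = 0 -> (dsubmx W)^T *m usubmx W = (usubmx W)^T *m dsubmx W.
  by rewrite wronE => /eqP; rewrite subr_eq0 => /eqP ->.
have [T eT] : exists T, T = Fmx (ciM Y Z) by eexists.
have tT : T^T = T by rewrite eT tr_Fmx.
have [G eG] : exists G, G = pinv (usubmx Y) *m usubmx Z *m T by eexists.
have XG : usubmx Y *m G = usubmx Z *m T.
  have := frame_EF_ker (z := Z *m T) fY (frame_vert R n).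
  rewrite !(mulmxA _ Z) -/(wron Y Z) -/(wron (vert R n) Z) !wron_vertl.
  have -> : Fmx (- usubmx Y) = Fmx (usubmx Y).
    by rewrite /Fmx pinv_opp mulNmx mulmxN opprK.
  have -> : Emx (- usubmx Y) = Emx (usubmx Y).
    by rewrite /Emx pinv_opp mulNmx mulmxN opprK.
  rewrite mulmxA -/(ciM Y Z) {1}eT mul_Fmx => /(_ erefl)/eqP.
  rewrite mulNmx mulmxN oppr_eq0 mulmxBl mul1mx subr_eq0 => /eqP ->.
  by rewrite eG !mulmxA.
have -> : ciP Y Z = T *m ((dsubmx Z)^T *m usubmx Z) *m T
    - G^T *m ((usubmx Y)^T *m dsubmx Y) *m G.
  have -> : ciP Y Z = T *m (wron Y Z)^T *m G by rewrite /ciP -eT eG !mulmxA.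
  rewrite wronE trmxB !trmx_mul !trmxK mulmxBr mulmxBl; congr (_ - _).
    by rewrite -!mulmxA XG.
  by rewrite !mulmxA -trmx_mul XG trmx_mul tT ?mulmxA.
by rewrite trmxB !trmx_mul !trmxK tT symXU // [in X in _ - X]symXU // !mulmxA.
Qed.

(* [s = 1] gives mu_dual and [s = -1] gives mu. *)
Definition mu_sgn Y Z : nat := (\rank (ciM Y Z) + ind (s *: - ciP Y Z))%N.

Definition chart_ind t Y Z : nat := ind (s *: (chartQ t Y - chartQ t Z)).

(** Up to invertible factors the Wronskian is the difference of slopes, and swapping the frames
    negates this difference, so [rank_ind] applies. *)
Lemma rank_wron_chart t Y Z : frame Y -> frame Z ->
  chartC t Y \in unitmx -> chartC t Z \in unitmx ->
  \rank (wron Y Z) = (chart_ind t Y Z + chart_ind t Z Y)%N.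
Proof.
move=> [YY _] [ZZ _] uY uZ; have qY := chartQ_sym YY uY; have qZ := chartQ_sym ZZ uZ.
have sD : (s *: (chartQ t Z - chartQ t Y))^T = s *: (chartQ t Z - chartQ t Y).
  by rewrite linearZ /= raddfB /= qY qZ.
have s0 : s != 0 by case: hs => ->; rewrite ?oppr_eq0 oner_eq0.
rewrite (wron_chart uY uZ) qY mxrankMfree ?row_free_unit //.
set D := chartQ t Z - chartQ t Y in sD *.
rewrite -mxrank_tr trmx_mul trmxK mxrankMfree ?row_free_unit // mxrank_tr.
transitivity (\rank (s *: D)); first by rewrite mxrank_scale_nz.
rewrite [RHS]addnC; apply: etrans (rank_ind sD) _; congr (_ + _)%N.
by rewrite /chart_ind -scalerN opprB.
Qed.

Lemma ind_Smx_chart t (Y : nat -> 'M[R]_(n + n, n)) k :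
  (forall i, (i <= k)%N -> frame (Y i)) ->
  (forall i, (i <= k)%N -> chartC t (Y i) \in unitmx) ->
  ind (s *: Smx Y 0 k.+1) =
  (\sum_(i < k) chart_ind t (Y i) (Y i.+1) + chart_ind t (Y k) (Y 0))%N.
Proof.
move=> fY uY; have qY i : (i <= k)%N -> (chartQ t (Y i))^T = chartQ t (Y i).
  by move=> ik; apply: chartQ_sym; [have [] := fY i ik | apply: uY].
pose C i := chartC t (Y i); pose Q i := chartQ t (Y i).
pose D l := Q l - (if l == k then Q 0%N else Q l.+1).
have -> : Smx Y 0 k.+1 = \mxblock_(i < k.+1, j < k.+1)
    (if (i < j)%N then chart_form C Q i j
     else if (j < i)%N then (chart_form C Q j i)^T else 0).
  apply: eq_mxblock => i j.
  have wE (a b : 'I_k.+1) : w Y (0 + a) (0 + b) = chart_form C Q a b.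
    have [ak bk] : (a <= k)%N /\ (b <= k)%N by have := ltn_ord a; have := ltn_ord b.
    by rewrite /w (wron_chart (t := t)) ?uY // qY.
  by rewrite !wE.
rewrite (ind_cyclic (D := D)) //; last 2 first.
- by move=> l lk; rewrite /D ltn_eqF.
- by rewrite /D eqxx.
transitivity (\sum_(i < k) ind (s *: D i) + ind (s *: D k))%N.
  by rewrite big_ord_recr.
apply: (f_equal2 addn); last by rewrite /D eqxx.
by apply: eq_bigr => i _; rewrite /D ltn_eqF.
Qed.

(** The index for the triple (-V, Y, Z) is computed by [ind_Smx_chart] and by eliminating -V
    together with Y. The rank of X in the second count is h(Y, V) + h(V, Y), and h(V, Y) cancels. *)
Lemma mu_sgn_chart t Y Z : frame Y -> frame Z ->
  chartC t Y \in unitmx -> chartC t Z \in unitmx ->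
  (mu_sgn Y Z + chart_ind t Y (vert R n))%N =
  (chart_ind t Y Z + chart_ind t Z (vert R n))%N.
Proof.
move=> fY fZ uY uZ; set V := vert R n.
have fV := frame_vert R n.
have uV : chartC t V \in unitmx.
  by rewrite /chartC col_mxKd col_mxKu scaler0 subr0 unitmx1.
have uNV : chartC t (- V) \in unitmx by rewrite chartCN unitmxN.
pose F i := if i is i'.+1 then (if i' is 0 then Y else Z) else - V.
have fF i : (i <= 2)%N -> frame (F i).
  by case: i => [|[|i]] _; [apply: frameN | |].
have uF i : (i <= 2)%N -> chartC t (F i) \in unitmx by case: i => [|[|i]].
have qN : chartQ t (- V) = chartQ t V by apply: chartQN.
have eF : ind (s *: Smx F 0 3) =
    (chart_ind t V Y + chart_ind t Y Z + chart_ind t Z V)%N.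
  have sum2 (f : nat -> nat) : (\sum_(i < 2) f i = f 0 + f 1)%N.
    by rewrite !big_ord_recl big_ord0 addn0.
  rewrite (ind_Smx_chart fF uF) (sum2 (fun i => chart_ind t (F i) (F i.+1))).
  rewrite (_ : chart_ind t (F 0) (F 1) = chart_ind t V Y).
    rewrite (_ : chart_ind t (F 2) (F 0) = chart_ind t Z V).
      reflexivity.
    by rewrite /chart_ind qN.
  by rewrite /chart_ind qN.
have e6 := rank_wron_chart fY fV uY uV.
have e7 : \rank (wron Y V) = \rank (usubmx Y).
  by rewrite -mxrank_tr wron_tr mxrank_opp wron_vertl mxrank_opp.
set X := usubmx Y; set w12 := wron Y Z.
pose M := ciM Y Z; pose P := ciP Y Z.
have eM : M = Fmx (wron V Y) *m w12.
  by rewrite wron_vertl /Fmx pinv_opp mulNmx mulmxN opprK.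
have eX : (Emx (wron V Y) *m wron V Z :=: Fmx (wron V Y) *m w12)%MS.
  exact: frame_EF_eqmx.
have : ind (s *: Smx F 0 3) = (\rank X + (\rank M + ind (s *: - P)))%N.
  rewrite ind_Smx3.
  have -> : row_mx (w F 0 1) (w F 0 2) = - row_mx (wron V Y) (wron V Z).
    by rewrite /w /= !wronNl opp_row_mx.
  rewrite (ind_schur3_sgn hs (X := M) (trmx0 _ _ _) eX); last by right.
  rewrite {1}wron_vertl mxrank_opp; congr (_ + _)%N.
  set D := w12^T *m pinv (wron V Y) *m wron V Z.
  have sD : (0 - D - D^T)^T = 0 - D - D^T by rewrite !trmxB trmxK trmx0 addrAC.
  rewrite (ind_block0_sgn hs _ sD); congr (_ + _)%N.
  have FDF : Fmx M *m D *m Fmx M = P.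
    by rewrite /D !wron_vertl pinv_opp !(mulmxN, mulNmx) opprK /P /ciP !mulmxA.
  (* The factor 2 does not affect the index, and the minus sign is why [s = 1] belongs to the dual
     index. *)
  have -> : Fmx M *m (0 - D - D^T) *m Fmx M = - (2 *: P).
    rewrite sub0r -opprD mulmxN mulNmx (mulmxDr (Fmx M)) mulmxDl FDF.
    have -> : Fmx M *m D^T *m Fmx M = P.
      rewrite -[RHS](ciP_sym fY fZ) -/P -FDF (trmx_mul (Fmx M *m D)).
      by rewrite (trmx_mul (Fmx M)) tr_Fmx mulmxA.
    by rewrite scaler_nat mulr2n.
  rewrite -scalerN scalerA mulrC -scalerA ind_scale ?ltr0n //.
  by rewrite linearZ /= trmxN (ciP_sym fY fZ).
rewrite eF -/P -/M /mu_sgn -e7 e6 -/P -/M.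
move: (chart_ind _ _ _) (chart_ind _ _ _) (chart_ind _ _ _) (chart_ind _ _ _).
move: (\rank M) (ind _).
lia.
Qed.

End ComparativeIndex.

(** [M i j] and [h i j] differ by [v j - v i], which telescopes along the chain to the difference in
    the closing term. *)
Lemma cyclic_sum_coboundary (M h : nat -> nat -> nat) (v : nat -> nat) m :
  (2 <= m)%N ->
  (forall i j, (1 <= i <= m)%N -> (1 <= j <= m)%N -> M i j + v i = h i j + v j)%N ->
  \sum_(1 <= k < m) (M k k.+1)%:Z - (M 1 m)%:Z =
  \sum_(1 <= k < m) (h k k.+1)%:Z - (h 1 m)%:Z.
Proof.
move=> m2 e.
have eZ i j : (1 <= i <= m)%N -> (1 <= j <= m)%N ->
    (M i j)%:Z = (h i j)%:Z + ((v j)%:Z - (v i)%:Z).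
  by move=> im jm; have := e i j im jm; lia.
rewrite eZ; try lia.
have -> : \sum_(1 <= k < m) (M k k.+1)%:Z =
    \sum_(1 <= k < m) ((h k k.+1)%:Z + ((v k.+1)%:Z - (v k)%:Z)).
  by apply: eq_big_nat => k k1m; apply: eZ; lia.
rewrite big_split /= (telescope_sumr (fun k => (v k)%:Z)) ?(ltnW m2) //.
by rewrite opprD addrACA subrr addr0.
Qed.

Lemma sum_nat1_recr q (f : nat -> nat) :
  (\sum_(1 <= k < q.+2) f k = \sum_(i < q) f i.+1 + f q.+1)%N.
Proof. by rewrite big_nat_recr //= big_add1 big_mkord. Qed.

(** * Cyclic sums *)

Section Main.
Variables (R : realType) (n : nat) (s : R).
Hypothesis hs : s = 1 \/ s = - 1.

Definition nu_sgn (Y : nat -> 'M[R]_(n + n, n)) m : int :=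
  \sum_(1 <= k < m) (mu_sgn s (Y k) (Y k.+1))%:Z - (mu_sgn s (Y 1) (Y m))%:Z.

(* Moving Y_m in front with the opposite sign does not change the form S,
   because w_(k,m)^T = - w_(m,k). *)
Definition cyc_seq (Y : nat -> 'M[R]_(n + n, n)) m i :=
  if i is i'.+1 then Y i else - Y m.

(** The cyclic index ends with h(m, 1), whereas the cyclic sum subtracts h(1, m); the two add up to
    the rank of w_(m,1). *)
Lemma nu_sgnE (Y : nat -> 'M[R]_(n + n, n)) q :
  (forall k, (1 <= k <= q.+2)%N -> frame (Y k)) ->
  nu_sgn Y q.+2 + (\rank (w Y q.+2 1))%:Z =
  (ind (s *: Smx (cyc_seq Y q.+2) 0 q.+2))%:Z.
Proof.
set m := q.+2 => fY.
have [t ut] : exists t, forall k, (1 <= k <= m)%N -> chartC t (Y k) \in unitmx.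
  have [|t ut] := @chart_ex _ _ 'I_m (fun i => Y i.+1).
    by move=> i; apply: fY; rewrite ltn_ord.
  exists t => -[//|k] km; exact: (ut (Ordinal (km : (k < m)%N))).
have f1 : frame (Y 1) by apply: fY.
have fm : frame (Y m) by apply: fY; rewrite leqnn.
have u1 : chartC t (Y 1) \in unitmx by apply: ut.
have um : chartC t (Y m) \in unitmx by apply: ut; rewrite leqnn.
pose h i j := chart_ind s t (Y i) (Y j).
pose v i := chart_ind s t (Y i) (vert R n).
have muE i j : (1 <= i <= m)%N -> (1 <= j <= m)%N ->
    (mu_sgn s (Y i) (Y j) + v i = h i j + v j)%N.
  by move=> im jm; apply: mu_sgn_chart; [| apply: fY | apply: fY | apply: ut | apply: ut].
have -> : nu_sgn Y m = \sum_(1 <= k < m) (h k k.+1)%:Z - (h 1 m)%:Z.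
  exact: (cyclic_sum_coboundary (M := fun i j => mu_sgn s (Y i) (Y j)) _ muE).
have -> : ind (s *: Smx (cyc_seq Y m) 0 m) = (h m 1 + \sum_(1 <= k < m) h k k.+1)%N.
  have fZ i : (i <= q.+1)%N -> frame (cyc_seq Y m i).
    by case: i => [|i] im; [exact: frameN fm | apply: (fY i.+1); apply: leqW].
  have uZ i : (i <= q.+1)%N -> chartC t (cyc_seq Y m i) \in unitmx.
    by case: i => [|i] im; [rewrite chartCN unitmxN | apply: (ut i.+1); apply: leqW].
  rewrite (ind_Smx_chart s fZ uZ); set Z := cyc_seq Y m.
  (* The sign of the first frame does not affect its slope. *)
  have qN : chartQ t (Z 0) = chartQ t (Y m) := chartQN um.
  have h0 : chart_ind s t (Z 0) (Z 1) = h m 1.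
    exact: (f_equal (fun x => ind (s *: (x - chartQ t (Y 1)))) qN).
  have hl : chart_ind s t (Z q.+1) (Z 0) = h q.+1 m.
    exact: (f_equal (fun x => ind (s *: (chartQ t (Y q.+1) - x))) qN).
  rewrite (sum_nat1_recr q (fun k => h k k.+1)) big_ord_recl -addnA.
  have hi (i : 'I_q) : chart_ind s t (Z (lift ord0 i)) (Z (lift ord0 i).+1) = h i.+1 i.+2.
    exact: erefl.
  exact: (f_equal2 addn h0 (f_equal2 addn (eq_bigr _ (fun i _ => hi i)) hl)).
rewrite (rank_wron_chart hs fm f1 um u1) -/(h m 1) -/(h 1 m) !PoszD.
rewrite (big_morph Posz PoszD (erefl _)).
move: (\sum_(_ <= _ < _) _) (h m 1) (h 1 m) => a b c; lia.
Qed.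

(** The index in [nu_sgnE] is expanded in two ways, clearing the first block row or the first two.
    The sizes [p] and [q] are variables so that successors can be substituted inside the types. *)
Lemma nu_sgn_formulas (Y : nat -> 'M[R]_(n + n, n)) m p q
    (X : 'M[R]_(n, \sum_(j < q) n)) :
  p = q.+1 -> m = q.+2 ->
  (forall k, (1 <= k <= m)%N -> frame (Y k)) ->
  let wm := w Y m 1 in
  let W := \mxrow_(j < p) w Y m (1 + j) in
  let N := \mxrow_(j < q) w Y m (2 + j) in
  let K := \mxrow_(j < q) w Y 1 (2 + j) in
  let D := K^T *m pinv wm *m N in
  let SD := Smx Y 2 q - D - D^T in
  X = Emx wm *m N \/ X = Fmx wm *m K ->
  [/\ nu_sgn Y m = (\rank X + ind (s *: (Fmx W *m Smx Y 1 p *m Fmx W)))%N%:Z,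
      nu_sgn Y m = (ind (s *: block_mx 0 X X^T SD))%:Z
    & nu_sgn Y m = (\rank X + ind (s *: (Fmx X *m SD *m Fmx X)))%N%:Z].
Proof.
move=> -> ->; set m' := q.+2 => fY wm W N K D SD hX.
have f1 : frame (Y 1) by apply: fY.
have fm : frame (Y m') by apply: fY; rewrite leqnn.
have eX : (Emx wm *m N :=: Fmx wm *m K)%MS.
  (* With the row of Y_2, .., Y_(m-1) as [z], the Wronskian rows of Y_m and Y_1 become [N] and
     [K]. *)
  have := frame_EF_eqmx (\mxrow_(j < q) Y (2 + j)%N) f1 fm.
  by rewrite !mul_mxrow.
have rX : \rank X = \rank (Emx wm *m N).
  by case: hX => -> //; apply/esym/(eqmx_rank _); apply/eqmxP.
have sD : SD^T = SD by rewrite /SD !trmxB trmxK Smx_sym addrAC.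
have nuE := nu_sgnE fY; rewrite -/m' -/wm in nuE.
set Z := cyc_seq Y m' in nuE.
have wZ j : w Z 0 j.+1 = - w Y m' j.+1 by rewrite /w /= wronNl.
have i1 : ind (s *: Smx Z 0 m') =
    (\rank W + ind (s *: (Fmx W *m Smx Y 1 q.+1 *m Fmx W)))%N.
  rewrite ind_Smx_recl.
  have -> : \mxrow_(j < q.+1) w Z 0 (1 + j) = - W.
    by rewrite -mxrowN; apply: eq_mxrow => j; apply: wZ.
  rewrite (ind_block0_sgn hs _ (Smx_sym Z 1 q.+1)) mxrank_opp.
  by rewrite /Fmx pinv_opp mulNmx mulmxN opprK.
have i2 : ind (s *: Smx Z 0 m') = (\rank wm + ind (s *: block_mx 0 X X^T SD))%N.
  rewrite ind_Smx_recl2.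
  have -> : row_mx (w Z 0 1) (\mxrow_(j < q) w Z 0 (2 + j)) = - row_mx wm N.
    rewrite opp_row_mx wZ -mxrowN; congr row_mx; apply: eq_mxrow => j; exact: wZ.
  exact: (ind_schur3_sgn hs (Smx_sym Y 2 q) eX hX).
(* Cancelling [\rank wm] against the term in [nu_sgnE] leaves [\rank X] in the first formula. *)
have rW : \rank W = (\rank wm + \rank X)%N.
  rewrite rX -rank_row_mx_E /W mxrow_recl_const.
  have castE r r' (e : r = r') (A : 'M[R]_(n, r)) : \rank (castmx (erefl, e) A) = \rank A.
    by case: _ / e.
  rewrite castE; apply: (f_equal (fun B => \rank (row_mx wm B))).
  by apply: eq_mxrow => j; rewrite lift0.
have e2 : nu_sgn Y m' = (ind (s *: block_mx 0 X X^T SD))%:Z.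
  move: nuE; rewrite i2 PoszD; move: (nu_sgn _ _) (\rank wm) (ind _) => a b c; lia.
split => //.
- move: nuE; rewrite i1 rW -addnA PoszD.
  move: (nu_sgn _ _) (\rank wm) (_ + _)%N => a b c; lia.
- by rewrite e2 (ind_block0_sgn hs _ sD).
Qed.

End Main.

Theorem theorem3p4 (R : realType) (n m : nat) (Y : nat -> 'M[R]_(n + n, n))
    (m_ge2 : (2 <= m)%N)
    (frameY : forall k, (1 <= k <= m)%N -> frame (Y k))
    (X : 'M[R]_(n, \sum_(j < m - 2) n))
    (defX : X = Mtilde Y m \/ X = Mmx Y m) :
  (nu_plus Y m =
     (\rank X + ind (Fmx (Wmx Y m) *m Smx Y 1 (m - 1) *m Fmx (Wmx Y m)))%N%:Z
   /\
   nu_minus Y m =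
     (\rank X + ind (- (Fmx (Wmx Y m) *m Smx Y 1 (m - 1) *m Fmx (Wmx Y m))))%N%:Z)
  /\
  ((3 <= m)%N ->
   (nu_plus Y m = (ind (Sbar Y X))%:Z /\
    nu_plus Y m = (\rank X + ind (Fmx X *m SDmx Y m *m Fmx X))%N%:Z)
   /\
   (nu_minus Y m = (ind (- Sbar Y X))%:Z /\
    nu_minus Y m = (\rank X + ind (- (Fmx X *m SDmx Y m *m Fmx X)))%N%:Z)).
Proof.
have e1 : (m - 1)%N = (m - 2).+1 by lia.
have e2 : m = (m - 2).+2 by lia.
have [p1 p2 p3] := nu_sgn_formulas (or_introl erefl) e1 e2 frameY defX.
have [n1 n2 n3] := nu_sgn_formulas (or_intror erefl) e1 e2 frameY defX.
have eP : nu_sgn 1 Y m = nu_plus Y m.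
  by congr (_ - _); first apply: eq_bigr => k _; rewrite /mu_sgn scale1r.
have eN : nu_sgn (-1) Y m = nu_minus Y m.
  by congr (_ - _); first apply: eq_bigr => k _; rewrite /mu_sgn scaleN1r opprK.
rewrite eP !scale1r in p1 p2 p3; rewrite eN !scaleN1r in n1 n2 n3.
by split; [split | move=> _; split; split].
Qed.
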